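(* Let $T$ be an equilateral compact metric tree with $p\ge 2$ vertices, rooted at $v_0$, with edges of length $\ell>0$ and real-valued potentials $q_j\in L^2(0,\ell)$ on the edges. Let $T_\infty$ be the graph obtained from $T$ by attaching a half-infinite lead $e_0=[0,\infty)$ at $v_0$, with potential $q_0=0$ on $e_0$ and standard conditions imposed at all vertices of $T_\infty$. Let $F$ and $\widehat F$ be the functions defined in the context via the reduced Jost function $\widetilde E$ (which gives the $S$-function of $T_\infty$, $S(\sqrt\lambda)=\widetilde E(-\sqrt\lambda)/\widetilde E(\sqrt\lambda)$) and the common zeros of $\phi_D$ and $\phi_N$, that is, the set $\mathrm{Sp}(L_D)\cap \mathrm{Sp}(L_N)$. Put $$z_k=\frac{k}{p},\quad \sqrt{\lambda_k^{(n)}}=\frac{\arccos z_k+2\pi n}{\ell},\qquad k=0,1,\dots,p,\ n=1,2,\dots,$$ $$\hat z_{\hat k}=\frac{\hat k}{p-1},\quad \sqrt{\hat\lambda_{\hat k}^{(n)}}=\frac{\arccos \hat z_{\hat k}+2\pi n}{\ell},\qquad \hat k=0,1,\dots,p-1,\ n=1,2,\dots,$$ and define the scattering information $$f_k=\lim_{n\to\infty}F\big(\sqrt{\lambda_k^{(n)}}\big),\ k=0,\dots,p,\qquad \hat f_{\hat k}=\lim_{n\to\infty}\widehat F\big(\sqrt{\hat\lambda_{\hat k}^{(n)}}\big),\ \hat k=0,\dots,p-1.$$ Then the polynomials $\psi(z)=\det(-zD+A)$ and $\widehat\psi(z)=\det(-z\widehat D+\widehat A)$ associated with $T$ (of degrees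 $p$ and $p-1$) are uniquely determined by the scattering information, by finding their coefficients from the relations $$\psi(z_k)=f_k,\ k=0,1,\dots,p,\qquad \widehat\psi(\hat z_{\hat k})=\hat f_{\hat k},\ \hat k=0,1,\dots,p-1.$$ That is, these relations hold, and $\psi$ (respectively, $\widehat\psi$) is the unique polynomial of degree at most $p$ (respectively, at most $p-1$) satisfying them.
   Context: Tree. $T$ is a finite metric tree with $p\ge2$ vertices and $g=p-1\ge1$ edges $e_1,\dots,e_g$, all of the same length $\ell>0$, with a chosen vertex $v_0$ as root (interior or pendant). $d(v)$ is the degree of $v$ in $T$ (the lead is not counted). Edges are directed away from the root and each is identified with $[0,\ell]$, $x=0$ being its initial vertex; each vertex $v\ne v_0$ has exactly one incoming edge. The edges outgoing from $v_0$ are $e_1,\dots,e_{d(v_0)}$. On $e_j$ consider $-y_j''+q_jy_j=\lambda y_j$ with $q_j\in L^2(0,\ell)$ real-valued. Combinatorial polynomials. $A$ is the adjacency matrix of $T$ with first row and column corresponding to $v_0$, $D$ is the diagonal matrix of the degrees $d(v)$ in the same order; $\widehat A,\widehat D$ are obtained from $A,D$ by deleting the first row and first column. Vertex conditions. Standard conditions at $v\neq v_0$ with incoming edge $e_j$: $y_j'(\ell)=0$ if $v$ is pendant; if $v$ is interior, $y_j(\ell)=y_k(0)$ for every edge $e_k$ outgoing from $v$ and $y_j'(\ell)=\sum_k y_k'(0)$, the sum being over edges outgoing from $v$. Standard conditions at $v_0$ in $T$: $y_1(0)=y_k(0)$ for $k=2,\dots,d(v_0)$ and $\sum_{k=1}^{d(v_0)}y_k'(0)=0$.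 Dirichlet condition at $v_0$: $y_k(0)=0$, $k=1,\dots,d(v_0)$. $L_N$ (resp. $L_D$) is the operator $(y_j)\mapsto(-y_j''+q_jy_j)$ in $\bigoplus_{j=1}^gL^2(0,\ell)$ with domain all $(y_j)\in\bigoplus_{j=1}^g H^2(0,\ell)$ satisfying standard conditions at all $v\ne v_0$ and the standard (resp. Dirichlet) condition at $v_0$. On $T_\infty$, the lead $e_0=[0,\infty)$ is outgoing from $v_0$, carries the equation $-y_0''=\lambda y_0$, and the standard conditions at $v_0$ are $y_0(0)=y_k(0)$, $k=1,\dots,d(v_0)$, $\sum_{k=0}^{d(v_0)}y_k'(0)=0$. $\mathrm{Sp}$ denotes the spectrum. Characteristic functions. Let $c_j(\sqrt\lambda,x)$, $s_j(\sqrt\lambda,x)$ solve the equation on $e_j$ with $c_j=1,c_j'=0$ and $s_j=0,s_j'=1$ at $x=0$. Writing $y_j=a_jc_j+b_js_j$, the vertex conditions become a $2g\times2g$ linear system for $(a_1,\dots,a_g,b_1,\dots,b_g)^\top$ with matrix $\Phi_D(\lambda)$ (Dirichlet at $v_0$) or $\Phi_N(\lambda)$ (standard at $v_0$). The first $d(v_0)$ rows express $a_1=0,\dots,a_{d(v_0)}=0$ for $\Phi_D$, and $a_1-a_2=0,\dots,a_1-a_{d(v_0)}=0$, $b_1+\dots+b_{d(v_0)}=0$ for $\Phi_N$; the remaining rows, identical and in the same order for both, express the conditions $y_j(\ell)-y_k(0)=0$ and $y_j'(\ell)-\sum_ky_k'(0)=0$ at the vertices $v\neq v_0$. Set $\phi_D=\det\Phi_D$,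 $\phi_N=\det\Phi_N$, both multiplied, if necessary, by one common sign $\pm1$ (depending only on the rooted tree and the chosen orderings) so that for identically zero potentials $\phi_N(\lambda)=\sqrt\lambda\,(\sin(\sqrt\lambda\ell))^{-1}\psi(\cos(\sqrt\lambda\ell))$ and $\phi_D(\lambda)=\widehat\psi(\cos(\sqrt\lambda\ell))$. The functions $\phi_D,\phi_N$ are entire in $\lambda$, and their zeros are the eigenvalues of $L_D$, $L_N$, respectively. Scattering data. The Jost function is $E(\sqrt\lambda)=\phi_N(\lambda)+i\sqrt\lambda\,\phi_D(\lambda)$ and the $S$-function is $S(\sqrt\lambda)=E(-\sqrt\lambda)/E(\sqrt\lambda)$. Let $\lambda_j^0\ne0$, $j=1,\dots,j_0$ ($0\le j_0\le\infty$), be the nonzero common zeros of $\phi_D$ and $\phi_N$, each repeated according to the minimum of its multiplicities as a zero of $\phi_D$ and of $\phi_N$; let $m$ be the minimum of the multiplicities of $\lambda=0$ as a zero of $\phi_D$ and of $\phi_N$ ($m=0$ if $\phi_D(0)\ne0$ or $\phi_N(0)\neq0$). Write $$\phi_D(\lambda)=\lambda^m\prod_{j=1}^{j_0}\Big(1-\frac{\lambda}{\lambda_j^0}\Big)\widetilde\phi_D(\lambda),\qquad \phi_N(\lambda)=\lambda^m\prod_{j=1}^{j_0}\Big(1-\frac{\lambda}{\lambda_j^0}\Big)\widetilde\phi_N(\lambda),$$ where $\widetilde\phi_D,\widetilde\phi_N$ have no common zeros (an empty product is $1$), and set $\widetilde E(\sqrt\lambda)=\widetilde\phi_N(\lambda)+i\sqrt\lambda\,\widetilde\phi_D(\lambda)$.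 Then $$F(\sqrt\lambda)=\frac{\sin(\sqrt\lambda\ell)}{2\sqrt\lambda}\lambda^m\prod_{j=1}^{j_0}\Big(1-\frac{\lambda}{\lambda_j^0}\Big)\big(\widetilde E(\sqrt\lambda)+\widetilde E(-\sqrt\lambda)\big),$$ $$\widehat F(\sqrt\lambda)=\frac{1}{2i\sqrt\lambda}\lambda^m\prod_{j=1}^{j_0}\Big(1-\frac{\lambda}{\lambda_j^0}\Big)\big(\widetilde E(\sqrt\lambda)-\widetilde E(-\sqrt\lambda)\big).$$ When $p=2$, $\hat z_{\hat k}=\hat k$ for $\hat k=0,1$. *)

(* Defs.v *)
From HB Require Import structures.
From mathcomp Require Import all_boot all_order all_algebra.
From mathcomp Require Import complex.
From mathcomp Require Import all_classical all_reals all_analysis.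

Set Implicit Arguments.
Unset Strict Implicit.
Unset Printing Implicit Defensive.

Import Order.TTheory GRing.Theory Num.Theory.
Import numFieldNormedType.Exports.

Local Open Scope classical_set_scope.
Local Open Scope ring_scope.

(* The complex numbers, declared at type [numClosedFieldType] so that the
   topology and the complex derivative of the library are inferred on them. *)
Definition Cx (R : realType) : numClosedFieldType := R[i].

Definition ofR (R : realType) (x : R) : Cx R := (x%:C)%C.
Definition mkC (R : realType) (x y : R) : Cx R := (x +i* y)%C.
Definition reC (R : realType) (z : Cx R) : R := complex.Re z.
Definition imC (R : realType) (z : Cx R) : R := complex.Im z.

Section ComplexFunctions.
Variable R : realType.
Implicit Types (z : Cx R) (f : Cx R -> Cx R).

Definition coshR (x : R) : R := (expR x + expR (- x)) / 2.
Definition sinhR (x : R) : R := (expR x - expR (- x)) / 2.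

Definition Ccos z : Cx R :=
  mkC (cos (reC z) * coshR (imC z)) (- (sin (reC z) * sinhR (imC z))).
Definition Csin z : Cx R :=
  mkC (sin (reC z) * coshR (imC z)) (cos (reC z) * sinhR (imC z)).

Definition entire f := forall z, derivable (f : (Cx R)^o -> (Cx R)^o) z 1.

Definition zero_multiplicity f z (k : nat) :=
  exists h : Cx R -> Cx R,
    [/\ entire h, h z != 0 & forall w, f w = (w - z) ^+ k * h w].

(* Lebesgue integral over [0, x] of a complex-valued function. *)
Definition Cintegral (x : R) (f : R -> Cx R) : Cx R :=
  mkC (\int[@lebesgue_measure R]_(t in `[0, x]) reC (f t))
      (\int[@lebesgue_measure R]_(t in `[0, x]) imC (f t)).

End ComplexFunctions.

(* A tree on the vertices 0, ..., g with root 0.  Edge [j] goes from [esrc j]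
   to [edst j]; [etree_away] says that it points away from the root: some path
   from the root to its initial vertex avoids its terminal vertex.  The edges
   outgoing from the root come first in the numbering. *)
Section Trees.
Variable g : nat.

Definition is_tree (adj : rel 'I_g.+1) :=
  [/\ symmetric adj, irreflexive adj,
      forall v w, connect adj v w
    & forall s : seq 'I_g.+1, ucycle adj s -> (size s <= 2)%N].

Definition vdeg (adj : rel 'I_g.+1) (v : 'I_g.+1) : nat := #|[pred w | adj v w]|.

Record rooted_tree := RootedTree {
  tadj : rel 'I_g.+1;
  esrc : 'I_g -> 'I_g.+1;
  edst : 'I_g -> 'I_g.+1;
  tadj_tree : is_tree tadj;
  etree_edges : forall v w, tadj v w <->
    exists j, (v = esrc j /\ w = edst j) \/ (v = edst j /\ w = esrc j);
  etree_inj : injective (fun j => [set esrc j; edst j]%SET);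
  etree_away : forall j, exists s : seq 'I_g.+1,
    [/\ path tadj ord0 s, last ord0 s = esrc j & edst j \notin ord0 :: s];
  etree_root : forall j : 'I_g, (esrc j == ord0) = (j < vdeg tadj ord0)%N
}.

Variable K : comNzRingType.
Variable T : rooted_tree.

Definition adjacency_mx : 'M[K]_g.+1 := \matrix_(v, w) (tadj T v w)%:R.
Definition degree_mx : 'M[K]_g.+1 :=
  diag_mx (\row_v (vdeg (tadj T) v)%:R).

Definition psi : {poly K} :=
  \det (- 'X *: map_mx polyC degree_mx + map_mx polyC adjacency_mx).

Definition psi_hat : {poly K} :=
  \det (- 'X *: map_mx polyC (row' ord0 (col' ord0 degree_mx))
        + map_mx polyC (row' ord0 (col' ord0 adjacency_mx))).

End Trees.

Section CharacteristicFunctions.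
Variables (R : realType) (g : nat).

Definition L2_on (l : R) (q : R -> R) :=
  measurable_fun `[0, l] q /\
  (@lebesgue_measure R).-integrable `[0, l] (fun t => (q t ^+ 2)%:E).

(* [y] is an H^2(0, l) solution of -y'' + q y = lam y with derivative [dy]:
   [y] and [dy] are absolutely continuous on [0, l], with a.e. derivatives
   [dy] and (q - lam) y. *)
Definition solves (l : R) (q : R -> R) (lam : Cx R) (y dy : R -> Cx R) :=
  [/\ {within `[0, l], continuous y},
      {within `[0, l], continuous dy},
      forall x, 0 <= x <= l -> y x = y 0 + Cintegral x dy
    & forall x, 0 <= x <= l ->
        dy x = dy 0 + Cintegral x (fun t => (ofR (q t) - lam) * y t)].

(* Edge-indexed families c_j, c_j', s_j, s_j' of functions of (lam, x). *)
Record fundamental_family := FundamentalFamily {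
  fc : 'I_g -> Cx R -> R -> Cx R;
  dfc : 'I_g -> Cx R -> R -> Cx R;
  fs : 'I_g -> Cx R -> R -> Cx R;
  dfs : 'I_g -> Cx R -> R -> Cx R
}.

Definition is_fundamental (l : R) (q : 'I_g -> R -> R)
    (u : fundamental_family) :=
  forall j lam,
    [/\ solves l (q j) lam (fc u j lam) (dfc u j lam),
        fc u j lam 0 = 1 /\ dfc u j lam 0 = 0,
        solves l (q j) lam (fs u j lam) (dfs u j lam)
      & fs u j lam 0 = 0 /\ dfs u j lam 0 = 1].

Variable T : rooted_tree g.

Let d0 := vdeg (tadj T) ord0.

(* Left (resp. right) half of a row: coefficients of a_1, ..., a_g
   (resp. b_1, ..., b_g). *)
Definition row_dirichlet (i : 'I_g) : 'rV[Cx R]_(g + g) :=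
  row_mx (\row_j (j == i)%:R) 0.

(* a_1 - a_{i+2} = 0 for 0 <= i < d0 - 1, then b_1 + ... + b_d0 = 0. *)
Definition row_standard (i : 'I_g) : 'rV[Cx R]_(g + g) :=
  if (i.+1 < d0)%N
  then row_mx (\row_j ((j == 0%N :> nat)%:R - (j == i.+1 :> nat)%:R)) 0
  else row_mx 0 (\row_j (j < d0)%:R).

(* y_j(l) - y_k(0), where e_j is the edge coming into the initial vertex of
   e_k. *)
Definition row_continuity (u : fundamental_family) l lam (k : 'I_g) :
    'rV[Cx R]_(g + g) :=
  row_mx (\row_j ((edst T j == esrc T k)%:R * fc u j lam l - (j == k)%:R))
         (\row_j ((edst T j == esrc T k)%:R * fs u j lam l)).

(* y_i'(l) - \sum_k y_k'(0), over the edges e_k leaving the terminal vertex of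
   e_i; the sum is empty when that vertex is pendant. *)
Definition row_kirchhoff (u : fundamental_family) l lam (i : 'I_g) :
    'rV[Cx R]_(g + g) :=
  row_mx (\row_j ((j == i)%:R * dfc u j lam l))
         (\row_j ((j == i)%:R * dfs u j lam l - (esrc T j == edst T i)%:R)).

(* The first d0 rows are the conditions at the root.  The remaining rows of the
   upper block are indexed by the edges not leaving the root, those of the lower
   block by the vertices other than the root, via their incoming edges. *)
Definition system_mx (root_row : 'I_g -> 'rV[Cx R]_(g + g))
    (u : fundamental_family) l lam : 'M[Cx R]_(g + g) :=
  col_mx
    (\matrix_(i < g)
       if (i < d0)%N then root_row i else row_continuity u l lam i)
    (\matrix_(i < g) row_kirchhoff u l lam i).

Definition Phi_D := system_mx row_dirichlet.
Definition Phi_N := system_mx row_standard.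

(* [s] stands for the square root of lambda. *)
Definition normalized_by (sgn : Cx R) :=
  forall (l : R) (u : fundamental_family), 0 < l ->
    is_fundamental l (fun _ _ => 0) u ->
    forall s : Cx R, Csin (s * ofR l) != 0 ->
      sgn * \det (Phi_N u l (s ^+ 2)) =
        s / Csin (s * ofR l) * (psi (Cx R) T).[Ccos (s * ofR l)]
      /\ sgn * \det (Phi_D u l (s ^+ 2)) =
        (psi_hat (Cx R) T).[Ccos (s * ofR l)].

(* The common sign of the two determinants: it depends on [T] only, and is
   chosen so that the zero-potential formulas hold. *)
Definition tree_sign : Cx R := if `[< normalized_by 1 >] then 1 else -1.

Definition phi_D (u : fundamental_family) (l : R) (lam : Cx R) : Cx R :=
  tree_sign * \det (Phi_D u l lam).
Definition phi_N (u : fundamental_family) (l : R) (lam : Cx R) : Cx R :=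
  tree_sign * \det (Phi_N u l lam).

End CharacteristicFunctions.

Section Scattering.
Variable R : realType.
Implicit Types (phiD phiN : Cx R -> Cx R) (s lam : Cx R) (nu : nat -> Cx R).

Definition jost phiD phiN s : Cx R := phiN (s ^+ 2) + 'i * s * phiD (s ^+ 2).

Definition S_function phiD phiN s : Cx R :=
  jost phiD phiN (- s) / jost phiD phiN s.

Definition common_multiplicity phiD phiN lam (k : nat) :=
  exists kD kN, [/\ zero_multiplicity phiD lam kD,
                    zero_multiplicity phiN lam kN & k = minn kD kN].

(* [None] stands for infinity; sequences are numbered from 0. *)
Definition below (j0 : option nat) (j : nat) : bool :=
  if j0 is Some N then (j < N)%N else true.

Definition zero_product (j0 : option nat) nu lam : Cx R :=
  lim ((\prod_(0 <= j < n | below j0 j) (1 - lam / nu j) : Cx R) @[n --> \oo]).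

(* The finite or infinite family (nu j), [below j0 j], lists the nonzero common
   zeros with their common multiplicities, [m] is the common multiplicity of 0,
   and [tphiD], [tphiN] are the corresponding cofactors. *)
Record reduced_factorization phiD phiN (m : nat) (j0 : option nat) nu
    (tphiD tphiN : Cx R -> Cx R) : Prop := ReducedFactorization {
  rf_neq0 : forall j, below j0 j -> nu j != 0;
  rf_mult : forall lam, lam != 0 -> exists2 k,
    common_multiplicity phiD phiN lam k &
    ([set j | below j0 j /\ nu j = lam] #= `I_k)%card;
  rf_mult0 : common_multiplicity phiD phiN 0 m;
  rf_entireD : entire tphiD;
  rf_entireN : entire tphiN;
  rf_D : forall lam, phiD lam = lam ^+ m * zero_product j0 nu lam * tphiD lam;
  rf_N : forall lam, phiN lam = lam ^+ m * zero_product j0 nu lam * tphiN lam;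
  rf_nocommon : forall lam, ~ (tphiD lam = 0 /\ tphiN lam = 0)
}.

Definition scat_F (l : R) (m : nat) (j0 : option nat) nu
    (tE : Cx R -> Cx R) s : Cx R :=
  Csin (s * ofR l) / (2 * s) * (s ^+ 2) ^+ m * zero_product j0 nu (s ^+ 2)
  * (tE s + tE (- s)).

Definition scat_Fhat (m : nat) (j0 : option nat) nu
    (tE : Cx R -> Cx R) s : Cx R :=
  (2 * 'i * s)^-1 * (s ^+ 2) ^+ m * zero_product j0 nu (s ^+ 2)
  * (tE s - tE (- s)).

(* The node k / N. *)
Definition node (N k : nat) : R := k%:R / N%:R.

Definition sqrt_lambda (l : R) (N k n : nat) : R :=
  (acos (node N k) + 2 * pi * n%:R) / l.

End Scattering.

(* Main.v *)
Require Import Defs.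
From HB Require Import structures.
From mathcomp Require Import all_boot all_order all_algebra all_fingroup.
From mathcomp Require Import complex.
From mathcomp Require Import all_classical all_reals all_analysis.
From mathcomp Require Import measurable_realfun ring lra.

(** The reduced Jost function only hides a common factor: [F] at [s] equals
[sin (s l) / s * phi_N (s ^ 2)], and [Fhat] at [s] equals [phi_D (s ^ 2)]
([scat_FE], [scat_FhatE]).  So the theorem is about the behaviour of the two
characteristic determinants along frequencies [w n] that tend to infinity with
[w n * l] fixed modulo [2 pi].

At such frequencies the potentials disappear in the limit.  After rescaling
derivatives by the frequency, the values at the far ends of the solutions tend
to [cos], [- sin], [sin], [cos] of the fixed phase
([free_comparison], [cvg_fundamental]), hence each determinant, with its power
of the frequency taken out ([det_Phi_D_scale], [det_Phi_N_scale]), tends to the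
determinant of a system with constant coefficients [C], [- S], [S], [C],
where [C = z_k] and [C ^ 2 + S ^ 2 = 1].

That determinant is combinatorial.  Number the non-root vertices by their
incoming edges, which is possible because the graph is a tree ([edst_inj]), and
take the values [C a_j + S b_j] at the far ends as unknowns instead of
[(a_j, b_j)]: the continuity equations become trivial, and the Kirchhoff
equations become the system with matrix [- C D + A] for the vertex values, or
its reduction at the root ([mul_N_P], [det_edge_block], [det_rooted_block]).  So
the limits are [psi] and [psi_hat] at [C], up to the sign [(-1) ^+ d0], with
[d0] the degree of the root ([det_Phi_N_uniform], [det_Phi_D_uniform]).  The
same computation applied to the zero potential, whose solutions are
trigonometric by a Wronskian argument, shows that this sign is the
normalizing one ([tree_signE]).

Finally, [psi] and [psi_hat] have degrees [p] and [p - 1], because all vertex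
degrees are positive ([size_psi], [size_psi_hat]), and a polynomial of such a
degree is determined by its values at the distinct nodes
([poly_eq_on_nodes]). *)

Set Implicit Arguments.
Unset Strict Implicit.
Unset Printing Implicit Defensive.

Import Order.TTheory GRing.Theory Num.Theory.
Import numFieldNormedType.Exports.

Local Open Scope classical_set_scope.
Local Open Scope ring_scope.

(** * The edges of a rooted tree as its non-root vertices *)

Section TreeStructure.
Variables (g : nat) (T : rooted_tree g).
Local Notation adj := (tadj T).
Implicit Types (j k : 'I_g) (v w : 'I_g.+1).

Lemma tadj_sym : symmetric adj.
Proof. by case: (tadj_tree T). Qed.

Lemma edge_tadj j : adj (esrc T j) (edst T j).
Proof. by apply/etree_edges; exists j; left. Qed.

Lemma edst_neq_root j : edst T j != ord0.
Proof.
have [s [_ _]] := etree_away T j.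
by rewrite inE negb_or => /andP[].
Qed.

Let off v : rel 'I_g.+1 := fun x y => [&& adj x y, x != v & y != v].

Lemma root_connect_off j :
  connect (off (edst T j)) ord0 (esrc T j).
Proof.
have [s [ps ls ns]] := etree_away T j; apply/connectP; exists s => //.
elim: s {ls} ord0 ps ns => //= y s IH x /andP[xy ps].
rewrite !inE !negb_or => /and3P[vx vy vs].
rewrite /= {1}/off xy (eq_sym x) vx (eq_sym y) vy /=; apply: IH => //.
by rewrite inE negb_or vy.
Qed.

(** If two edges ended at [v], their initial vertices would both be joined to
the root by paths avoiding [v]; a simple path between these two vertices,
closed up through [v], would be a cycle of length at least three. *)
Lemma edst_inj : injective (edst T).
Proof.
move=> j k jk; apply: (@etree_inj _ T); congr [set _; _]%SET => //.
apply/eqP/negPn/negP => njk.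
set v := edst T j.
have offC : connect_sym (off v).
  apply: sym_connect_sym => x y.
  by rewrite /off (tadj_sym x y); congr (_ && _); exact: andbC.
have : connect (off v) (esrc T j) (esrc T k).
  apply: (connect_trans (y := ord0)); first by rewrite offC root_connect_off.
  by rewrite /v jk root_connect_off.
case/connectP => p0 pp0 lp0.
case/shortenP: pp0 lp0 => p pp up _ lp.
have [_ _ _ /(_ (v :: esrc T j :: p))] := tadj_tree T.
have pN : p != [::] by apply: contra_neq njk => p0'; rewrite lp p0'.
suff cyc : ucycle adj (v :: esrc T j :: p).
  by move=> /(_ cyc) /=; case: (p) pN.
have pv : v \notin esrc T j :: p.
  have nv : esrc T j != v.
    have /= := edge_tadj j; case: (tadj_tree T) => _ irr _ _.
    by apply: contraTneq => ->; rewrite irr.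
  elim: (p) {up lp pN} (esrc T j) pp nv => [|y p' IH] x /=.
    by rewrite !inE eq_sym => _ /negPf->.
  move=> /andP[/and3P[xy vx vy] py] _.
  by rewrite in_cons negb_or eq_sym vx /=; exact: IH.
rewrite /ucycle cons_uniq pv up !andbT [path.cycle _ _]/= rcons_path -lp.
rewrite tadj_sym edge_tadj /v jk edge_tadj andbT /=.
by apply: sub_path pp => x y /= /and3P[].
Qed.

(** Every non-root vertex is numbered by its incoming edge.  The default value
is never taken, as no edge ends at the root. *)
Definition vperm_fun j : 'I_g := odflt j (unlift ord0 (edst T j)).

Lemma lift_vperm_fun j : lift ord0 (vperm_fun j) = edst T j.
Proof.
rewrite /vperm_fun; case: unliftP => [k //|] e.
by have := edst_neq_root j; rewrite e eqxx.
Qed.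

Lemma vperm_fun_inj : injective vperm_fun.
Proof. by move=> j k jk; apply: edst_inj; rewrite -!lift_vperm_fun jk. Qed.

Definition vperm : 'S_g := perm vperm_fun_inj.

Lemma lift_vperm j : lift ord0 (vperm j) = edst T j.
Proof. by rewrite permE lift_vperm_fun. Qed.

Lemma big_vertices (V : nmodType) (F : 'I_g.+1 -> V) :
  \sum_v F v = F ord0 + \sum_j F (edst T j).
Proof.
rewrite big_ord_recl (reindex_inj (perm_inj (s := vperm))); congr (_ + _).
by apply: eq_bigr => j _; rewrite lift_vperm.
Qed.

Lemma tadj_edst j k :
  adj (edst T j) (edst T k) = (edst T j == esrc T k) || (edst T k == esrc T j).
Proof.
apply/idP/idP => [/etree_edges[i [[e1 e2]|[e1 e2]]]|/orP[/eqP->|/eqP->]].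
- by rewrite e1 (edst_inj e2) eqxx.
- by rewrite e2 (edst_inj e1) eqxx orbT.
- exact: edge_tadj.
- by rewrite tadj_sym edge_tadj.
Qed.

Lemma esrc_edst_asym j k :
  (edst T j == esrc T k) && (edst T k == esrc T j) = false.
Proof.
apply/negP => /andP[/eqP e1 /eqP e2].
have jk : j = k.
  by apply: (@etree_inj _ T); rewrite /= e1 e2 finset.setUC.
have := edge_tadj j; rewrite -e2 jk.
by case: (tadj_tree T) => _ -> _ _.
Qed.

Lemma tadj_edst_nat j k : adj (edst T j) (edst T k) =
  ((edst T j == esrc T k) + (edst T k == esrc T j))%N :> nat.
Proof.
by rewrite tadj_edst; have := esrc_edst_asym j k; do 2!case: eqP.
Qed.

Lemma tadj_root j : adj ord0 (edst T j) = (esrc T j == ord0).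
Proof.
apply/idP/eqP => [/etree_edges[i [[e1 e2]|[e1 e2]]]|<-]; last exact: edge_tadj.
- by rewrite (edst_inj e2).
- by have := edst_neq_root i; rewrite -e1 eqxx.
Qed.

Lemma vdeg_sum v : vdeg adj v = (adj v ord0 + \sum_j adj v (edst T j))%N.
Proof.
rewrite /vdeg -sum1_card big_mkcond.
exact: (big_vertices (fun w => nat_of_bool (adj v w))).
Qed.

Lemma vdeg_root : vdeg adj ord0 = (\sum_j (esrc T j == ord0))%N.
Proof.
rewrite vdeg_sum; case: (tadj_tree T) => _ -> _ _; rewrite add0n.
by apply: eq_bigr => j _; rewrite tadj_root.
Qed.

(** The neighbours of the terminal vertex of [j] are the terminal vertices of
its outgoing edges, and the initial vertex of [j]. *)
Lemma vdeg_edst j : vdeg adj (edst T j) = (\sum_k (edst T j == esrc T k))%N.+1.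
Proof.
rewrite vdeg_sum tadj_sym tadj_root.
under eq_bigr do rewrite tadj_edst_nat.
rewrite big_split /= addnCA -[RHS]addn1; congr (_ + _)%N.
transitivity (\sum_v (esrc T j == v))%N.
  rewrite (eq_bigr (fun k => nat_of_bool (esrc T j == edst T k))).
    by apply: esym; exact: (big_vertices (fun v => nat_of_bool (esrc T j == v))).
  by move=> k _; rewrite eq_sym.
rewrite (bigD1 (esrc T j)) //= eqxx big1 // => w /negPf.
by rewrite eq_sym => ->.
Qed.

Lemma vdeg_root_gt0 : (0 < g)%N -> (0 < vdeg adj ord0)%N.
Proof.
move=> g0; have [s [ps ls _]] := etree_away T (Ordinal g0).
case: s ps ls => [|x s] /=.
  by move=> _ /esym/eqP; rewrite etree_root => /(leq_ltn_trans (leq0n _)).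
by move=> /andP[x0 _] _; rewrite /vdeg (cardD1 x) inE x0.
Qed.

Lemma vdeg_gt0 v : (0 < g)%N -> (0 < vdeg adj v)%N.
Proof.
move=> g0; have [->|[k ->]] : v = ord0 \/ exists k, v = lift ord0 k.
- by case: (unliftP ord0 v) => [k|] ->; [right; exists k|left].
- exact: vdeg_root_gt0.
- by rewrite -(permKV vperm k) lift_vperm vdeg_edst.
Qed.

End TreeStructure.

(** * Block determinants of edge systems *)

Section BlockDeterminants.
Variables (K : fieldType) (g : nat).
Implicit Types (E : 'M[K]_g) (r : 'cV[K]_g) (C S : K).

Lemma det_row_col_perm n (s : 'S_n) (A : 'M[K]_n) :
  \det (row_perm s (col_perm s A)) = \det A.
Proof.
rewrite row_permE col_permE !det_mulmx !det_perm odd_permV mulrCA.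
by rewrite -signr_addb addbb mulr1.
Qed.

Lemma det_castmx n n' (e : n = n') (A : 'M[K]_n) :
  \det (castmx (e, e) A) = \det A.
Proof. by case: n' / e; rewrite castmx_id. Qed.

(** A quarter turn is a product of three transvections. *)
Lemma det_block_rot : \det (block_mx 0 (- 1%:M) 1%:M 0 : 'M[K]_(g + g)) = 1.
Proof.
have -> : block_mx 0 (- 1%:M) 1%:M 0 =
  block_mx 1%:M (- 1%:M) 0 1%:M *m block_mx 1%:M 0 1%:M 1%:M
    *m block_mx 1%:M (- 1%:M) 0 1%:M :> 'M[K]_(g + g).
  rewrite !mulmx_block !(mul0mx, mul1mx, mulmx0, mulmx1, addr0, add0r).
  by rewrite subrr mul0mx add0r addNr.
by rewrite !det_mulmx !det_ublock det_lblock !det1 !mul1r.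
Qed.

(** When [E] is the matrix that sends each edge to its parent edge, this is
[A - C D] with the row and the column of the root deleted: [E + E^T] records
adjacency, and [1 + E^T E] is diagonal and counts neighbours. *)
Definition reduced_kernel E C : 'M[K]_g :=
  E + E^T - C *: (1%:M + E^T *m E).

(** In the system for [(a, b)] with [c_j = s_j' = C] and [s_j = - c_j' = S] at
the far ends, [eta = C a + S b] are the values at the far ends and
[alpha = E eta - a] the defects of continuity.  [N] is the matrix of that
system up to a rotation of its row blocks, and [P] expresses [(a, b)] through
[(eta, alpha)]. *)
Let N E C S : 'M[K]_(g + g) :=
  block_mx S%:M (E^T - C%:M) (C *: E - 1%:M) (S *: E).

Let P E C S : 'M[K]_(g + g) :=
  block_mx E (- 1%:M) (S^-1 *: (1%:M - C *: E)) (C / S)%:M.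

Let mxsimp := (mulmx0, mul0mx, mulmxDl, mulmxDr, mulNmx, mulmxN, mul1mx, mulmx1,
  =^~ scalemxAl, =^~ scalemxAr, mul_scalar_mx, mul_mx_scalar).

Lemma det_P E C S : S != 0 -> \det (P E C S) = S ^- g.
Proof.
move=> S0.
have -> : P E C S = block_mx 1%:M 0 (- (C / S))%:M (S^-1)%:M
   *m (block_mx 0 (- 1%:M) 1%:M 0 *m block_mx 1%:M 0 (- E) 1%:M).
  rewrite !mulmx_block !mxsimp !(addr0, add0r) opprK.
  by congr block_mx; apply/matrixP => i j; rewrite !mxE; field.
by rewrite !det_mulmx det_block_rot !det_lblock !det1 det_scalar exprVn !mul1r mulr1.
Qed.

(** In the unknowns [(eta, alpha)] the continuity equations read [alpha = 0],
and the Kirchhoff equations become a system for the vertex values [eta]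
alone. *)
Lemma mul_N_P E C S : S != 0 -> C ^+ 2 + S ^+ 2 = 1 ->
  exists J, N E C S *m P E C S =
    block_mx (S^-1 *: reduced_kernel E C) J 0 1%:M.
Proof.
move=> S0 CS; have hS : S ^+ 2 = 1 - C ^+ 2 by rewrite -CS addrAC subrr add0r.
eexists; rewrite mulmx_block; congr block_mx.
- rewrite /reduced_kernel !mxsimp; move: (E^T *m E) => X.
  by apply/matrixP => i j; rewrite !mxE; field: hS.
- rewrite !mxsimp; move: (E *m E) => X.
  by apply/matrixP => i j; rewrite !mxE; field.
- rewrite !mxsimp.
  by apply/matrixP => i j; rewrite !mxE; field.
Qed.

Definition edge_block E C S : 'M[K]_(g + g) :=
  block_mx (C *: E - 1%:M) (S *: E) (- S)%:M (C%:M - E^T).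

Lemma rot_edge_block E C S :
  block_mx 0 (- 1%:M) 1%:M 0 *m edge_block E C S = N E C S.
Proof.
rewrite mulmx_block !mxsimp.
by congr block_mx; apply/matrixP => i j; rewrite !mxE; field.
Qed.

(** For [S = 0] the matrix is block diagonal and [C * C = 1]; otherwise change
unknowns to the vertex values. *)
Lemma det_edge_block E C S : C ^+ 2 + S ^+ 2 = 1 ->
  \det (edge_block E C S) = \det (reduced_kernel E C).
Proof.
move=> CS; have [S0|S0] := eqVneq S 0.
  have C2 : C * C = 1 by rewrite -expr2 -CS S0 expr0n addr0.
  rewrite /edge_block S0 oppr0 scale0r raddf0 det_ublock mulrC -det_mulmx.
  congr (\det _); rewrite /reduced_kernel !mxsimp; move: (E^T *m E) => X.
  by apply/matrixP => i j; rewrite !mxE; ring: C2.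
have [J NP] := mul_N_P E S0 CS.
have := congr1 determinant NP.
rewrite -rot_edge_block !det_mulmx det_block_rot mul1r det_P //.
rewrite det_ublock det1 mulr1 detZ exprVn mulrC.
by apply: mulfI; rewrite invr_eq0 expf_neq0.
Qed.

(** With standard conditions at the root, take the common value at the root as
a further unknown: then the continuity equations have the same form on all
edges, and the Kirchhoff condition at the root, with [r] marking the edges that
leave it, is the one additional equation. *)
Definition rooted_block E r C S : 'M[K]_(1 + (g + g)) :=
  block_mx 0 (row_mx 0 r^T) (col_mx r 0) (edge_block E C S).

(** The change of unknowns of [mul_N_P], with the root value [t] added:
[a = E eta + r t - alpha]. *)
Lemma det_rooted_block E r C S : S != 0 -> C ^+ 2 + S ^+ 2 = 1 ->
  E^T *m r = 0 ->
  S * \det (rooted_block E r C S) =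
  \det (block_mx (- C *: (r^T *m r)) r^T r (reduced_kernel E C)).
Proof.
move=> S0 CS Er; have [J NP] := mul_N_P E S0 CS.
have hS : S ^+ 2 = 1 - C ^+ 2 by rewrite -CS addrAC subrr add0r.
have rE : r^T *m E = 0 by rewrite -[LHS]trmxK trmx_mul trmxK Er trmx0.
pose Q : 'M[K]_(1 + (g + g)) :=
  block_mx 1%:M 0 (col_mx r (- (C / S) *: r)) (P E C S).
pose Rot : 'M[K]_(1 + (g + g)) :=
  block_mx 1%:M 0 0 (block_mx 0 (- 1%:M) 1%:M 0).
have RM : Rot *m rooted_block E r C S =
  block_mx 0 (row_mx 0 r^T) (col_mx 0 r) (N E C S).
  rewrite mulmx_block rot_edge_block !mxsimp !(add0r, addr0) mul_block_col.
  by rewrite !mxsimp !(add0r, addr0).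
have RMQ : Rot *m rooted_block E r C S *m Q =
  block_mx (S^-1 *: (- C *: (r^T *m r))) (row_mx (S^-1 *: r^T) (C / S *: r^T))
    (col_mx (S^-1 *: r) 0)
    (block_mx (S^-1 *: reduced_kernel E C) J 0 1%:M).
  rewrite RM mulmx_block NP mul_row_col !mxsimp !(add0r, addr0).
  congr block_mx.
  - by rewrite !scalerA; congr (_ *: _); field.
  - rewrite mul_row_block !mxsimp rE.
    by congr row_mx; apply/matrixP => i j; rewrite !mxE; field.
  - rewrite mul_block_col !mxsimp Er.
    rewrite add_col_mx; move: (E *m r) => x.
    by congr col_mx; apply/matrixP => i j; rewrite !mxE; field: hS.
have := congr1 determinant RMQ.
rewrite block_mxA det_castmx row_mx0 det_ublock det1 mulr1 -scale_block_mx detZ.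
rewrite !det_mulmx det_ublock det1 mul1r det_block_rot mul1r.
rewrite det_lblock det1 mul1r det_P // exprS => e.
have Sg0 : S^-1 * S^-1 ^+ g != 0 by rewrite mulf_neq0 ?expf_neq0 ?invr_eq0.
apply: (mulfI Sg0); rewrite -e -exprVn; by field.
Qed.

End BlockDeterminants.

(** * The polynomials of the tree in the numbering by edges *)

Section VertexPolynomials.
Variables (K : fieldType) (g : nat) (T : rooted_tree g).
Local Notation adj := (tadj T).

Definition parent_mx : 'M[K]_g := \matrix_(k, j) (edst T j == esrc T k)%:R.
Definition root_col : 'cV[K]_g := \col_k (esrc T k == ord0)%:R.

(** The root ends no edge, so an edge leaving the root has no parent. *)
Lemma parent_root : parent_mx^T *m root_col = 0.
Proof.
apply/colP => j; rewrite !mxE big1 // => k _; rewrite !mxE.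
case: (esrc T k =P ord0) => [->|]; last by rewrite mulr0.
by rewrite (negPf (edst_neq_root T j)) mul0r.
Qed.

(** Each edge has at most one parent, so distinct columns of the parent matrix
have disjoint supports. *)
Lemma parent_gram j k : (parent_mx^T *m parent_mx) j k =
  ((j == k) * \sum_i (edst T j == esrc T i))%N%:R.
Proof.
rewrite mxE natrM natr_sum mulr_sumr; apply: eq_bigr => i _; rewrite !mxE.
rewrite -(inj_eq (@edst_inj _ T)).
case: (edst T j =P esrc T i) => [->|]; last by rewrite mul0r mulr0.
by rewrite mul1r mulr1 eq_sym.
Qed.

Lemma horner_detXDA n (D A : 'M[K]_n) C :
  (\det (- 'X *: map_mx polyC D + map_mx polyC A)).[C] = \det (- C *: D + A).
Proof.
rewrite -horner_evalE -det_map_mx; congr (\det _).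
by apply/matrixP => i j; rewrite !mxE [LHS]/= /horner_eval !hornerE.
Qed.

Lemma reduced_kernelE C j k : reduced_kernel parent_mx C j k =
  - C * (degree_mx K T) (edst T j) (edst T k)
  + (adjacency_mx K T) (edst T j) (edst T k).
Proof.
rewrite /reduced_kernel; have := parent_gram j k.
move: (parent_mx^T *m parent_mx) => X gE.
rewrite !mxE gE tadj_edst_nat vdeg_edst.
rewrite (inj_eq (@edst_inj _ T)) [in (edst T k == _)%:R + _]addrC natrD.
case: eqP => [->|_]; rewrite ?mul0n ?mul1n /=; ring.
Qed.

Lemma psi_hat_hornerE C :
  (psi_hat K T).[C] = \det (reduced_kernel parent_mx C).
Proof.
rewrite /psi_hat horner_detXDA -[LHS](det_row_col_perm (vperm T)); congr (\det _).
apply/matrixP => i j; rewrite reduced_kernelE -!lift_vperm.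
by rewrite !mxE.
Qed.

Lemma psi_hornerE C :
  (psi K T).[C] = \det (block_mx (- C *: (root_col^T *m root_col))
    root_col^T root_col (reduced_kernel parent_mx C)).
Proof.
rewrite /psi horner_detXDA -[LHS](det_row_col_perm (lift0_perm (vperm T))).
congr (\det _); apply/matrixP => i j.
have irr : adj ord0 ord0 = false by case: (tadj_tree T).
have perm0 (k : 'I_1) : lift0_perm (vperm T) (lshift g k) = ord0.
  by rewrite (_ : lshift g k = ord0) ?lift0_perm0 //; apply: val_inj; rewrite /= ord1.
have permS k : lift0_perm (vperm T) (rshift 1 k) = edst T k.
  by rewrite rshift1 lift0_perm_lift lift_vperm.
rewrite [LHS]mxE [LHS]mxE.
case: (@split_ordP 1 g i) => i' ->; case: (@split_ordP 1 g j) => j' ->.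
- rewrite [RHS](@block_mxEul K 1 g 1 g) !perm0 !mxE irr vdeg_root addr0 eqxx natr_sum.
  congr (_ * _); apply: eq_bigr => k _; rewrite !mxE.
  by case: eqP; rewrite ?mulr1 ?mulr0.
- rewrite [RHS](@block_mxEur K 1 g 1 g) perm0 permS !mxE tadj_root eq_sym.
  by rewrite (negPf (edst_neq_root T j')) mulr0n mulr0 add0r.
- rewrite [RHS](@block_mxEdl K 1 g 1 g) perm0 permS !mxE tadj_sym tadj_root.
  by rewrite (negPf (edst_neq_root T i')) mulr0n mulr0 add0r.
- by rewrite [RHS](@block_mxEdr K 1 g 1 g) !permS reduced_kernelE !mxE.
Qed.

End VertexPolynomials.

Section PsiDegrees.
Variables (g : nat) (T : rooted_tree g).
Local Notation adj := (tadj T).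

(** Dividing the rows by the degrees turns the determinant into a
characteristic polynomial. *)
Lemma size_detXDA (K : fieldType) n (d : 'rV[K]_n) (A : 'M[K]_n) :
  (forall i, d 0 i != 0) ->
  size (\det (- 'X *: map_mx polyC (diag_mx d) + map_mx polyC A)) = n.+1.
Proof.
move=> d0; pose B := \matrix_(i, j) ((d 0 i)^-1 * A i j).
have -> : - 'X *: map_mx polyC (diag_mx d) + map_mx polyC A =
    diag_mx (\row_i (- d 0 i)%:P) *m char_poly_mx B.
  rewrite mul_diag_mx; apply/matrixP => i j; rewrite !mxE.
  have dV : (d 0 i)%:P * ((d 0 i)^-1)%:P = 1 :> {poly K}.
    by rewrite -polyCM mulfV.
  by rewrite polyCN polyCM polyCMn; ring: dV.
rewrite det_mulmx det_diag -/(char_poly B).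
have -> : \prod_i (\row_i (- d 0 i)%:P) 0 i = (\prod_i (- d 0 i))%:P :> {poly K}.
  by rewrite rmorph_prod; apply: eq_bigr => i _; rewrite mxE.
rewrite mul_polyC size_scale ?size_char_poly //.
by apply/prodf_neq0 => i _; rewrite oppr_eq0.
Qed.

Lemma vdeg_natr_neq0 (K : numFieldType) v : (0 < g)%N ->
  (vdeg adj v)%:R != 0 :> K.
Proof. by move=> g0; rewrite pnatr_eq0 -lt0n vdeg_gt0. Qed.

Lemma size_psi (K : numFieldType) : (0 < g)%N -> size (psi K T) = g.+2.
Proof.
by move=> g0; apply: size_detXDA => i; rewrite mxE vdeg_natr_neq0.
Qed.

Lemma size_psi_hat (K : numFieldType) : (0 < g)%N -> size (psi_hat K T) = g.+1.
Proof.
move=> g0; rewrite /psi_hat.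
have -> : row' ord0 (col' ord0 (degree_mx K T)) =
    diag_mx (\row_i (vdeg adj (lift ord0 i))%:R).
  by apply/matrixP => i j; rewrite !mxE (inj_eq lift_inj).
by apply: size_detXDA => i; rewrite mxE vdeg_natr_neq0.
Qed.

(** The rows of the Laplacian of the tree sum to zero. *)
Lemma psi_at1 (K : fieldType) : (psi K T).[1] = 0.
Proof.
rewrite horner_detXDA; apply/eqP/det0P; exists (const_mx 1).
  apply/eqP => /rowP/(_ ord0); rewrite !mxE => /eqP.
  by rewrite oner_eq0.
apply/rowP => w; rewrite !mxE.
under eq_bigr do rewrite !mxE mul1r mulN1r.
rewrite big_split /= (bigD1 w) //= eqxx big1 ?addr0; last first.
  by move=> v /negPf ->; rewrite oppr0.
rewrite /vdeg -sum1_card natr_sum big_mkcond /= addrC; apply/eqP.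
rewrite subr_eq0; apply/eqP; apply: eq_bigr => v _.
by rewrite inE tadj_sym; case: (adj w v).
Qed.

End PsiDegrees.

(** * Determinants of the boundary systems *)

Section CyclicCombination.
Variable K : comNzRingType.

(** Applied to the rows [t - a_0], [a_0 - a_1], ..., [a_0 - a_(d-1)] and the
Kirchhoff row of the root, this moves the Kirchhoff row to the front and
rebuilds the rows [t - a_k]: a cyclic permutation, up to a unipotent factor. *)
Definition cyclic_mx n d : 'M[K]_n := \matrix_(i, j)
  if i == 0%N :> nat then (j == d :> nat)%:R
  else if (i <= d)%N then (j == i.-1 :> nat)%:R + ((j == 0%N :> nat) && (1 < i)%N)%:R
  else (j == i :> nat)%:R.

(** The first row has one nonzero entry, and the minor there is
unitriangular. *)
Lemma det_cyclic_mx n d : (d <= n)%N -> \det (cyclic_mx n.+1 d) = (-1) ^+ d.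
Proof.
move=> dn; rewrite (expand_det_row _ ord0).
pose jd : 'I_n.+1 := Ordinal (dn : (d < n.+1)%N).
rewrite (bigD1 jd) //= big1 ?addr0; last first.
  move=> j /eqP jE; rewrite mxE /= (_ : _ == _ = false) ?mul0r //.
  by apply/eqP => jd'; apply: jE; apply: val_inj.
rewrite mxE /= eqxx mul1r /cofactor /= add0n.
rewrite det_trig.
  rewrite big1 ?mulr1 // => i _; rewrite !mxE /= /bump /=.
  case: (leqP d i) => di; first by rewrite add1n eqxx.
  rewrite add0n eqxx; case: (nat_of_ord i) => [|i']; last by rewrite addr0.
  by rewrite addr0.
apply/is_trig_mxP => i j ij; rewrite !mxE /= /bump /= !add1n /=.
case: (leqP d i) => di.
  by rewrite (leq_trans di (ltnW ij)) add1n eqSS gtn_eqF.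
case: (leqP d j) => dj; rewrite ?add1n ?add0n /=.
  by rewrite (gtn_eqF (leqW ij)) addr0.
by rewrite (gtn_eqF ij) (gtn_eqF (leq_ltn_trans (leq0n i) ij)) addr0.
Qed.

Lemma sum_select (V : lmodType K) n (c : 'I_n -> K) (F : 'I_n -> V) (a : 'I_n) :
  (forall j : 'I_n, c j = (j == a :> nat)%:R) -> \sum_j c j *: F j = F a.
Proof.
move=> ca; rewrite (bigD1 a) //= ca eqxx scale1r big1 ?addr0 // => j.
by rewrite ca -val_eqE /= => /negPf ->; rewrite scale0r.
Qed.

Lemma sum_select2 (V : lmodType K) n (c : 'I_n -> K) (F : 'I_n -> V) (a b : 'I_n) :
  (forall j : 'I_n, c j = (j == a :> nat)%:R + (j == b :> nat)%:R) ->
  \sum_j c j *: F j = F a + F b.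
Proof.
move=> cab; under eq_bigr do rewrite cab scalerDl.
by rewrite big_split /=; congr (_ + _); apply: sum_select.
Qed.

End CyclicCombination.

Section SystemDeterminants.
Variables (R : realType) (g : nat) (T : rooted_tree g).
Local Notation K := (Cx R).
Local Notation adj := (tadj T).
Local Notation d0 := (vdeg (tadj T) ord0).

(** The system matrices depend on a family only through its values at the far
ends; constant families make these values the free parameters. *)
Definition const_family (c dc s ds : 'I_g -> K) : fundamental_family R g :=
  FundamentalFamily (fun j _ _ => c j) (fun j _ _ => dc j)
                    (fun j _ _ => s j) (fun j _ _ => ds j).

Definition uniform_family (C S : K) : fundamental_family R g :=
  const_family (fun _ => C) (fun _ => - S) (fun _ => S) (fun _ => C).

Lemma root_edge_edst (j k : 'I_g) : (k < d0)%N -> (edst T j == esrc T k) = false.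
Proof.
by rewrite -etree_root => /eqP ->; rewrite (negPf (edst_neq_root T j)).
Qed.

Lemma kirchhoff_rows C S l lam :
  \matrix_(i < g) row_kirchhoff T (uniform_family C S) l lam i =
  row_mx (- S)%:M (C%:M - (parent_mx K T)^T).
Proof.
apply/row_matrixP => i; rewrite rowK row_row_mx /row_kirchhoff /=.
congr row_mx; apply/rowP => j; rewrite !mxE eq_sym.
  by rewrite mulr_natl.
by rewrite mulr_natl [edst T i == _]eq_sym.
Qed.

Lemma continuity_row C S l lam k :
  row_continuity T (uniform_family C S) l lam k =
  row k (row_mx (C *: parent_mx K T - 1%:M) (S *: parent_mx K T)).
Proof.
rewrite row_row_mx /row_continuity /=; congr row_mx; apply/rowP => j.
  by rewrite !mxE mulrC eq_sym [j == k]eq_sym.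
by rewrite !mxE mulrC.
Qed.

(** The Dirichlet rows are the continuity rows with the opposite sign, since
edges that leave the root have no parent. *)
Lemma det_Phi_D_uniform C S l lam : C ^+ 2 + S ^+ 2 = 1 ->
  \det (Phi_D T (uniform_family C S) l lam) = (-1) ^+ d0 * (psi_hat K T).[C].
Proof.
move=> CS; rewrite psi_hat_hornerE -(det_edge_block _ CS).
pose d : 'rV[K]_g := \row_i (if (i < d0)%N then -1 else 1).
have -> : Phi_D T (uniform_family C S) l lam =
    block_mx (diag_mx d) 0 0 1%:M *m edge_block (parent_mx K T) C S.
  rewrite -[edge_block _ _ _]/(col_mx (row_mx _ _) (row_mx _ _)).
  rewrite mul_block_col mul0mx addr0 mul0mx add0r mul1mx.
  rewrite /Phi_D /system_mx kirchhoff_rows; congr col_mx.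
  apply/row_matrixP => k; rewrite rowK mul_diag_mx.
  have -> : row k (\matrix_(i, j) (d 0 i * (row_mx (C *: parent_mx K T - 1%:M)
     (S *: parent_mx K T)) i j)) = d 0 k *: row k (row_mx (C *: parent_mx K T - 1%:M)
     (S *: parent_mx K T)).
    by apply/rowP => j; rewrite !mxE.
  rewrite mxE; case: ifP => kd; last by rewrite scale1r continuity_row.
  rewrite row_row_mx scale_row_mx /row_dirichlet; congr row_mx; apply/rowP => j.
    rewrite !mxE root_edge_edst // mulr0 add0r mulrN mulN1r opprK.
    by rewrite eq_sym.
  by rewrite !mxE root_edge_edst // !mulr0.
rewrite det_mulmx det_ublock det1 mulr1 det_diag; congr (_ * _).
under eq_bigr do rewrite mxE.
rewrite -big_mkcond /= prodr_const; congr (_ ^+ _).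
rewrite [RHS]vdeg_root -sum1_card big_mkcond /=; apply: eq_bigr => i _.
by rewrite etree_root (_ : (i \in _) = (i < d0)%N) //; case: (i < d0)%N.
Qed.

(** Adding the root value as an unknown, together with its definition
[t = a_0], does not change the determinant; recombining the rows with
[cyclic_mx] then gives [rooted_block]. *)
Lemma det_Phi_N_uniform C S l lam : (0 < g)%N -> S != 0 ->
  C ^+ 2 + S ^+ 2 = 1 ->
  S * \det (Phi_N T (uniform_family C S) l lam) = (-1) ^+ d0 * (psi K T).[C].
Proof.
move=> g0 S0 CS; rewrite psi_hornerE.
rewrite -(det_rooted_block S0 CS (parent_root K T)) mulrCA; congr (_ * _).
have d0_gt0 := vdeg_root_gt0 T g0.
have d0_leg : (d0 <= g)%N.
  rewrite vdeg_root -[leqRHS]card_ord -sum1_card.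
  by apply: leq_sum => j _; case: eqP.
pose k0 : 'I_g := Ordinal g0.
have kd_lt : (d0.-1 < g)%N by rewrite prednK.
pose kd : 'I_g := Ordinal kd_lt.
(* The first row of [X] is [t - a_0]; the row [kd] of the system is the Kirchhoff
condition at the root. *)
pose X : 'M[K]_(1 + (g + g)) := block_mx 1%:M (row_mx (- delta_mx 0 k0) 0) 0
  (Phi_N T (uniform_family C S) l lam).
have detX : \det X = \det (Phi_N T (uniform_family C S) l lam).
  by rewrite det_ublock det1 mul1r.
suff <- : cyclic_mx K (1 + (g + g)) d0 *m X =
    rooted_block (parent_mx K T) (root_col K T) C S.
  rewrite det_mulmx det_cyclic_mx ?(leq_trans d0_leg) ?leq_addr // detX.
  by rewrite mulrA -expr2 sqrr_sign mul1r.
have X0 : row (lshift (g + g) ord0) X = row_mx 1%:M (row_mx (- delta_mx 0 k0) 0).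
  by rewrite rowKu row_row_mx !row_id.
have XU k : row (rshift 1 (lshift g k)) X = row_mx 0
   (if (k < d0)%N then row_standard R T k
    else row_continuity T (uniform_family C S) l lam k).
  by rewrite rowKd row_row_mx row0 /Phi_N rowKu rowK.
have XL k : row (rshift 1 (rshift g k)) X = row_mx 0
   (row_kirchhoff T (uniform_family C S) l lam k).
  by rewrite rowKd row_row_mx row0 /Phi_N rowKd rowK.
apply/row_matrixP => i; rewrite row_mul mulmx_sum_row.
case: (split_ordP i) => i' -> {i}.
  rewrite (@sum_select _ _ _ _ _ (rshift 1 (lshift g kd))).
    rewrite XU rowKu row_row_mx row_row_mx !row0.
    rewrite /= prednK // leqnn /row_standard /= prednK // ltnn.
    congr row_mx; congr row_mx; apply/rowP => j.
    by rewrite !mxE -etree_root.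
  by move=> j; rewrite !mxE /= ord1 /= (add1n d0.-1) prednK.
case: (split_ordP i') => k -> {i'}; last first.
  rewrite (@sum_select _ _ _ _ _ (rshift 1 (rshift g k))).
    rewrite XL rowKd row_row_mx rowKd row0; congr row_mx.
    by rewrite rowKd -(kirchhoff_rows C S l lam) rowK.
  move=> j; rewrite !mxE /= ifF //.
  by apply/negbTE; rewrite -ltnNge (add1n (g + k)) ltnS (leq_trans d0_leg) // leq_addr.
rewrite rowKd row_row_mx !rowKu.
case: (leqP d0 k) => kd0.
  rewrite (@sum_select _ _ _ _ _ (rshift 1 (lshift g k))).
    rewrite XU ltnNge kd0 /=; congr row_mx; last exact: continuity_row.
    by apply/rowP => j; rewrite !mxE etree_root ltnNge kd0.
  by move=> j; rewrite !mxE /= ifF // (add1n k) ltnNge kd0.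
have rk : row k (root_col K T) = 1%:M.
  by apply/rowP => j; rewrite !mxE !ord1 etree_root kd0.
rewrite rk row_row_mx.
have [k_eq0|k_gt0] := posnP k.
  rewrite (@sum_select _ _ _ _ _ (lshift (g + g) ord0)).
    rewrite X0; congr row_mx; congr row_mx; apply/rowP => j.
      rewrite !mxE root_edge_edst // mulr0 add0r -!val_eqE /= k_eq0.
      by rewrite [in LHS]eq_sym.
    by rewrite !mxE root_edge_edst // mulr0.
  by move=> j; rewrite !mxE /= (add1n k) k_eq0 d0_gt0 andbF addr0.
have kp : (k.-1 < g)%N by rewrite (leq_ltn_trans (leq_pred k)).
rewrite (@sum_select2 _ _ _ _ _ (rshift 1 (lshift g (Ordinal kp)))
  (lshift (g + g) ord0)).
  rewrite X0 XU /= (leq_ltn_trans (leq_pred k)) //.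
  rewrite /row_standard /= prednK // kd0 !add_row_mx add0r addr0.
  congr row_mx; congr row_mx; apply/rowP => j.
    rewrite !mxE root_edge_edst // mulr0 -!val_eqE /=.
    by rewrite [k == j :> nat]eq_sym; ring.
  by rewrite !mxE root_edge_edst // mulr0.
by move=> j; rewrite !mxE /= (add1n k) ltnS kd0 k_gt0 andbT (add1n k.-1) prednK.
Qed.

End SystemDeterminants.

Section SystemScaling.
Variables (R : realType) (g : nat) (T : rooted_tree g).
Local Notation K := (Cx R).
Local Notation d0 := (vdeg (tadj T) ord0).

Lemma row_diag_mul n p (d : 'rV[K]_n) (A : 'M[K]_(n, p)) i :
  row i (diag_mx d *m A) = d 0 i *: row i A.
Proof. by rewrite mul_diag_mx; apply/rowP => j; rewrite !mxE. Qed.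

(** Measure the derivatives at the far ends in units of [t], and the
coefficients of the [s_j] in units of [1 / t]; at frequency [t] all entries
then stay bounded.  [w] collects the effect on the rows at the root. *)
Lemma det_system_scale root_row (c dc s ds : 'I_g -> K) l lam (t : K) (w : 'rV[K]_g) :
  t != 0 ->
  (forall i : 'I_g, (i < d0)%N ->
    w 0 i *: (root_row i *m block_mx 1%:M 0 0 (t^-1)%:M) = root_row i) ->
  (forall i : 'I_g, (d0 <= i)%N -> w 0 i = 1) ->
  \det (system_mx T root_row (const_family c dc s ds) l lam) =
  \prod_i w 0 i *
  \det (system_mx T root_row
    (const_family c (fun j => dc j / t) (fun j => t * s j) ds) l lam).
Proof.
move=> t0 hroot w1.
have -> : system_mx T root_row (const_family c dc s ds) l lam =
    block_mx (diag_mx w) 0 0 t%:M *m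
    system_mx T root_row
      (const_family c (fun j => dc j / t) (fun j => t * s j) ds) l lam
    *m block_mx 1%:M 0 0 (t^-1)%:M.
  rewrite /system_mx mul_block_col !mul0mx addr0 add0r mul_col_mx.
  congr col_mx; apply/row_matrixP => i.
    rewrite row_mul row_diag_mul !rowK -scalemxAl.
    case: ltnP => id0; first by rewrite hroot.
    rewrite w1 // scale1r /row_continuity mul_row_block !mulmx0 addr0 add0r mulmx1.
    rewrite mul_mx_scalar; congr row_mx; apply/rowP => j; rewrite !mxE /=.
    by field.
  rewrite row_mul mul_scalar_mx; have -> : row i (t *: \matrix_(i0 < g) row_kirchhoff T
       (const_family c (fun j => dc j / t) (fun j => t * s j) ds) l lam i0) =
     t *: row_kirchhoff T
       (const_family c (fun j => dc j / t) (fun j => t * s j) ds) l lam i.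
    by apply/rowP => j; rewrite !mxE.
  rewrite rowK -scalemxAl /row_kirchhoff mul_row_block !mulmx0 addr0 add0r mulmx1.
  rewrite mul_mx_scalar scale_row_mx; congr row_mx; apply/rowP => j; rewrite !mxE /=.
    by field.
  by rewrite mulrA mulfV // mul1r.
rewrite !det_mulmx !det_ublock det1 !det_scalar mul1r det_diag exprVn.
by rewrite mulrAC mulfK ?expf_neq0.
Qed.

Lemma det_Phi_D_scale (c dc s ds : 'I_g -> K) l lam (t : K) : t != 0 ->
  \det (Phi_D T (const_family c dc s ds) l lam) =
  \det (Phi_D T
    (const_family c (fun j => dc j / t) (fun j => t * s j) ds) l lam).
Proof.
move=> t0; rewrite /Phi_D (@det_system_scale _ _ _ _ _ _ _ t (const_mx 1)) //.
- by rewrite big1 ?mul1r // => i _; rewrite mxE.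
- move=> i _; rewrite mxE scale1r mul_row_block.
  by rewrite !mulmx0 !mul0mx !addr0 mulmx1.
- by move=> i _; rewrite mxE.
Qed.

(** The extra factor comes from the Kirchhoff row at the root, the only row
there that involves the coefficients of the [s_j]. *)
Lemma det_Phi_N_scale (c dc s ds : 'I_g -> K) l lam (t : K) : (0 < g)%N -> t != 0 ->
  \det (Phi_N T (const_family c dc s ds) l lam) =
  t * \det (Phi_N T
    (const_family c (fun j => dc j / t) (fun j => t * s j) ds) l lam).
Proof.
move=> g0 t0; have d0_gt0 := vdeg_root_gt0 T g0.
have d0_leg : (d0.-1 < g)%N.
  rewrite prednK // vdeg_root -[leqRHS]card_ord -sum1_card.
  by apply: leq_sum => j _; case: eqP.
have iE (i : 'I_g) : (i == Ordinal d0_leg) = (i == d0.-1 :> nat) by [].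
rewrite /Phi_N (@det_system_scale _ _ _ _ _ _ _ t
  (\row_i if i == Ordinal d0_leg then t else 1)) //.
- congr (_ * _); rewrite (bigD1 (Ordinal d0_leg)) //= mxE eqxx big1 ?mulr1 //.
  by move=> i /negPf i0; rewrite mxE i0.
- move=> i id0; rewrite mxE iE /row_standard; case: (ltnP i.+1 d0) => id.
    rewrite ltn_eqF; last by rewrite -ltnS prednK.
    by rewrite scale1r mul_row_block !mulmx0 !mul0mx !addr0 mulmx1.
  have -> : (i == d0.-1 :> nat).
    by rewrite -eqSS prednK // eqn_leq id0 id.
  rewrite mul_row_block !mulmx0 !mul0mx !add0r scale_row_mx scaler0.
  by rewrite mul_mx_scalar scalerA mulfV // scale1r.
- move=> i id0; rewrite mxE iE gtn_eqF //.
  by rewrite (leq_trans _ id0) // prednK.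
Qed.

End SystemScaling.

(** * Primitives on a segment *)

Section RealPrimitives.
Variable R : realType.
Local Notation mu := (@lebesgue_measure R).
Implicit Types (f F y dy q : R -> R) (l x s : R).

Lemma integrable_within l f : {within `[0, l], continuous f} ->
  mu.-integrable `[0, l] (EFin \o f).
Proof. by move=> cf; apply: continuous_compact_integrable => //; exact: segment_compact. Qed.

Lemma integrable_sub_segment l x f : x <= l ->
  mu.-integrable `[0, l] (EFin \o f) -> mu.-integrable `[0, x] (EFin \o f).
Proof.
move=> xl; apply: integrableS => //.
by apply: subset_itvl; rewrite bnd_simp.
Qed.

Lemma is_derive_primitive l f F x : {within `[0, l], continuous f} ->
  (forall t, 0 <= t <= l -> F t = F 0 + \int[mu]_(r in `[0, t]) f r) ->
  0 < x < l -> is_derive x 1 F (f x).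
Proof.
move=> cf FE /andP[x0 xl]; have l0 := lt_trans x0 xl.
have fi := integrable_within cf.
have cx : {for x, continuous f}.
  by apply: within_continuous_continuous cf _ => //; rewrite in_itv /= x0 xl.
have [dG G'] := continuous_FTC1_closed xl fi x0 cx.
set G := (fun _ => _) in dG G'.
have FG : is_derive x 1 (cst (F 0) + G) (f x).
  by rewrite -[f x]add0r; apply: is_deriveD; rewrite -G' derive1E; exact: derivableP.
apply: near_eq_is_derive FG; near=> t; rewrite (FE t) //
; apply/andP; split; apply: ltW; near: t; [exact: lt_nbhsr|exact: lt_nbhsl].
Unshelve. all: by end_near. Qed.

Lemma primitive_continuous l f F : 0 <= l -> mu.-integrable `[0, l] (EFin \o f) ->
  (forall t, 0 <= t <= l -> F t = F 0 + \int[mu]_(r in `[0, t]) f r) ->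
  {within `[0, l], continuous F}.
Proof.
move=> l0 fi FE.
have cG := parameterized_integral_continuous l0 fi.
apply: (@subspace_eq_continuous _ _ _ (fun t => F 0 + parameterized_integral mu 0 t f)).
  by move=> t; rewrite inE /= in_itv /= => tl; apply: esym; exact: FE.
apply: (@within_continuousD _ _ _ _ (cst (F 0))) => //.
by apply: continuous_subspaceT => t; exact: cst_continuous.
Qed.

Lemma mean_value_bound l f F M x : 0 <= x <= l ->
  {within `[0, l], continuous F} ->
  (forall t, 0 < t < l -> is_derive t 1 F (f t)) ->
  (forall t, 0 <= t <= l -> `|f t| <= M) -> `|F x - F 0| <= M * l.
Proof.
move=> /andP[x0 xl] cF dF fM.
have sub : `[0, x] `<=` `[0, l] by apply: subset_itvl; rewrite bnd_simp.
have [| |c] := @MVT_segment R F f 0 x x0.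
- move=> t; rewrite in_itv /= => /andP[t0 tx]; apply: dF.
  by rewrite t0 (lt_le_trans tx).
- exact: continuous_subspaceW cF.
rewrite in_itv /= => /andP[c0 cx] ->; rewrite subr0 normrM (ger0_norm x0).
apply: ler_pM => //; apply: fM; rewrite c0.
by rewrite (le_trans cx).
Qed.

Lemma within_continuous_bounded l f : 0 <= l -> {within `[0, l], continuous f} ->
  exists2 c, 0 <= c <= l & forall t, 0 <= t <= l -> `|f t| <= `|f c|.
Proof.
move=> l0 cf.
have [|c] := @EVT_max R (fun t => `|f t|) 0 l l0.
  by move=> t; apply: continuous_comp; [exact: cf|exact: norm_continuous].
by rewrite in_itv /= => cl cmax; exists c => // t tl; apply: cmax; rewrite in_itv.
Qed.

Lemma integrable_mul_within l f y : 0 <= l ->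
  mu.-integrable `[0, l] (EFin \o f) -> {within `[0, l], continuous y} ->
  mu.-integrable `[0, l] (EFin \o (fun t => f t * y t)).
Proof.
move=> l0 fi cy; have [c _ cmax] := within_continuous_bounded l0 cy.
have -> : EFin \o (fun t => f t * y t) = ((EFin \o f) \* (EFin \o y))%E.
  by apply/funext => t; rewrite /= EFinM.
apply: integrableMl => //.
  by apply: subspace_continuous_measurable_fun => //; exact: measurable_itv.
exists `|y c|; split; first exact: num_real.
move=> M cM t /=; rewrite in_itv /= => tl.
by rewrite (le_trans (cmax _ tl)) // ltW.
Qed.

Lemma normr_Rintegral_mul l x f y e Y : 0 <= x <= l ->
  mu.-integrable `[0, l] (EFin \o f) -> {within `[0, l], continuous y} ->
  (\int[mu]_(t in `[0%R, l]) `|(f t)%:E| <= e%:E)%E ->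
  (forall t, 0 <= t <= l -> `|y t| <= Y) ->
  `|\int[mu]_(t in `[0, x]) (f t * y t)| <= e * Y.
Proof.
move=> /andP[x0 xl] fi cy fe yY; have l0 := le_trans x0 xl.
have Y0 : 0 <= Y by apply: le_trans (yY 0 _) => //; rewrite lexx.
have mfy : mu.-integrable `[0, x] (EFin \o (fun t => f t * y t)).
  by apply: (integrable_sub_segment xl); apply: integrable_mul_within.
have mf : mu.-integrable `[0, x] (EFin \o f) by exact: integrable_sub_segment fi.
have mabs z h : mu.-integrable `[0, z] (EFin \o h) ->
    measurable_fun `[0, z] (fun t => `|(h t)%:E|%E).
  by move=> /integrable_abse /measurable_int.
rewrite -lee_fin EFin_normr_Rintegral //.
apply: le_trans (le_abse_integral _ _ _) _ => //.
  exact: measurable_int mfy.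
apply: (@le_trans _ _ (\int[mu]_(t in `[0%R, x]) (Y%:E * `|(f t)%:E|)))%E.
  apply: ge0_le_integral => //.
  - exact: mabs mfy.
  - apply: measurable_funeM; exact: mabs mf.
  - move=> t /=; rewrite in_itv /= => /andP[t0 tx].
    rewrite normrM EFinM muleC; apply: lee_wpmul2r => //.
    by rewrite lee_fin yY // t0 (le_trans tx).
rewrite ge0_integralZl //; last exact: mabs mf.
rewrite EFinM muleC; apply: lee_wpmul2r => //; apply: le_trans fe.
apply: ge0_subset_integral => //.
- exact: mabs fi.
- by apply: subset_itvl; rewrite bnd_simp.
Qed.

End RealPrimitives.

(** * Real solutions at high frequency *)

Section RealSchrodinger.
Variable R : realType.
Local Notation mu := (@lebesgue_measure R).
Implicit Types (f F y dy q : R -> R) (l x s : R).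

Lemma is_derive_mull (s x : R) : is_derive x 1 ( *%R s) s.
Proof. by apply: is_derive_eq (is_deriveZ _ _) _; rewrite /GRing.scale /= mulr1. Qed.

Lemma is_derive_cosM s x : is_derive x 1 (fun t => cos (s * t)) (- s * sin (s * x)).
Proof.
have H := is_derive_mull s x.
by apply: is_derive_eq (is_derive1_comp _ _) _; rewrite mulrC mulrN mulNr.
Qed.

Lemma is_derive_sinM s x : is_derive x 1 (fun t => sin (s * t)) (s * cos (s * x)).
Proof.
have H := is_derive_mull s x.
by apply: is_derive_eq (is_derive1_comp _ _) _; rewrite mulrC.
Qed.

Definition real_solution l q s y dy :=
  [/\ {within `[0, l], continuous y}, {within `[0, l], continuous dy},
      forall x, 0 <= x <= l -> y x = y 0 + \int[mu]_(t in `[0, x]) dy t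
    & forall x, 0 <= x <= l ->
        dy x = dy 0 + \int[mu]_(t in `[0, x]) ((q t - s ^+ 2) * y t)].

Lemma integrable_fct_sub (l : R) (f h : R -> R) :
  mu.-integrable `[0, l] (EFin \o f) -> mu.-integrable `[0, l] (EFin \o h) ->
  mu.-integrable `[0, l] (EFin \o (fun t => f t - h t)).
Proof.
move=> fi hi.
have -> : EFin \o (fun t => f t - h t) = ((EFin \o f) \- (EFin \o h))%E.
  by apply/funext => t; rewrite /= EFinB.
by apply: integrableB => //; exact: measurable_itv.
Qed.

(** Comparison with the free solution.  Replace [q] by a continuous [qt] in the
equation for [dy]: the function [v] so obtained is continuously differentiable,
and [dy - v] is the integral of [(q - qt) y], hence at most [e * max |y|].  The
amplitudes [A] and [B] of [(y, v)] with respect to the cosine and the sine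
would be constant for the free equation; here their derivatives are at most
[(e + Q / s) * max |y|].  When [d] is small, evaluating at a point where [|y|]
is maximal bounds [max |y|] by the initial data, with no Gronwall
argument. *)
Lemma free_comparison (l : R) (q qt : R -> R) (s e Q : R) (y dy : R -> R) :
  0 < l -> 0 < s -> mu.-integrable `[0, l] (EFin \o q) ->
  continuous qt -> (forall t, 0 <= t <= l -> `|qt t| <= Q) ->
  (\int[mu]_(t in `[0%R, l]) `|(q t - qt t)%:E| <= e%:E)%E ->
  real_solution l q s y dy ->
  let d := (e + Q / s) * l in
  let k := `|y 0| + `|dy 0| / s in
  d <= 4^-1 ->
  `|y l - (y 0 * cos (s * l) + dy 0 / s * sin (s * l))| <= 4 * d * k /\
  `|dy l / s - (dy 0 / s * cos (s * l) - y 0 * sin (s * l))|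
    <= (4 * d + 2 * (e / s)) * k.
Proof.
move=> l0 s0 qi cqt qtQ qe [cy cdy yE dyE] d k d4.
have l0' := ltW l0.
have cqt' : {within `[0, l], continuous qt} by apply: continuous_subspaceT.
have qti := integrable_within cqt'.
have qqi : mu.-integrable `[0, l] (EFin \o (fun t => q t - qt t)).
  exact: integrable_fct_sub.
pose f (t : R) : R := (qt t - s ^+ 2) * y t.
have cf : {within `[0, l], continuous f}.
  move=> t; apply: cvgM; last exact: cy.
  by apply: cvgB; [exact: cqt'|exact: cvg_cst].
pose v (x : R) : R := dy 0 + \int[mu]_(t in `[0, x]) f t.
have v0 : v 0 = dy 0.
  by rewrite /v set_itv1 Rintegral_set1 addr0.
have vE (x : R) : 0 <= x <= l -> v x = v 0 + \int[mu]_(t in `[0, x]) f t.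
  by rewrite v0.
have fi := integrable_within cf.
have cv := primitive_continuous l0' fi vE.
have [c cl cmax] := within_continuous_bounded l0' cy.
set Y := `|y c| in cmax.
have wE (x : R) : 0 <= x <= l ->
    dy x - v x = \int[mu]_(t in `[0, x]) ((q t - qt t) * y t).
  move=> xl; have /andP[x0 xl'] := xl.
  have sub (h : R -> R) : mu.-integrable `[0, l] (EFin \o h) ->
    mu.-integrable `[0, x] (EFin \o h) by exact: integrable_sub_segment.
  rewrite dyE // /v opprD addrACA subrr add0r -RintegralB //.
  - by apply: eq_Rintegral => t _; rewrite /f; ring.
  - apply: sub; apply: integrable_mul_within => //.
    apply: (@integrable_fct_sub _ _ (fun=> s ^+ 2)) => //.
    by apply: integrable_within; apply: continuous_subspaceT => t; exact: cst_continuous.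
  - exact: sub.
have we (x : R) : 0 <= x <= l -> `|dy x - v x| <= e * Y.
  by move=> xl; rewrite wE //; exact: normr_Rintegral_mul qqi cy qe cmax.
pose A (t : R) : R := y t * cos (s * t) - v t * (s^-1 * sin (s * t)).
pose B (t : R) : R := y t * sin (s * t) + v t * (s^-1 * cos (s * t)).
pose A' (t : R) : R := (dy t - v t) * cos (s * t) - s^-1 * (qt t * y t) * sin (s * t).
pose B' (t : R) : R := (dy t - v t) * sin (s * t) + s^-1 * (qt t * y t) * cos (s * t).
have s_neq0 : s != 0 by rewrite gt_eqF.
have dyy (t : R) : 0 < t < l -> is_derive t 1 y (dy t) by apply: is_derive_primitive.
have dv (t : R) : 0 < t < l -> is_derive t 1 v (f t) by apply: is_derive_primitive.
have dA (t : R) : 0 < t < l -> is_derive t 1 A (A' t).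
  move=> tl; have := dyy t tl; have := dv t tl => dvt dyt.
  have dc := is_derive_cosM s t; have ds := is_derive_sinM s t.
  apply: is_derive_eq (is_deriveB _ _) _.
  by rewrite /GRing.scale /= /A' /f; field.
have dB (t : R) : 0 < t < l -> is_derive t 1 B (B' t).
  move=> tl; have := dyy t tl; have := dv t tl => dvt dyt.
  have dc := is_derive_cosM s t; have ds := is_derive_sinM s t.
  apply: is_derive_eq (is_deriveD _ _) _.
  by rewrite /GRing.scale /= /B' /f; field.
have cc (h : R -> R) : continuous h -> {within `[0, l], continuous h}.
  by move=> ch; exact: continuous_subspaceT.
have ccos : {within `[0, l], continuous (fun t => cos (s * t))}.
  by apply: cc => t; apply/differentiable_continuous/derivable1_diffP; case: (is_derive_cosM s t).
have csin : {within `[0, l], continuous (fun t => sin (s * t))}.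
  by apply: cc => t; apply/differentiable_continuous/derivable1_diffP; case: (is_derive_sinM s t).
have cA : {within `[0, l], continuous A}.
  move=> t; apply: cvgB; first by apply: cvgM; [exact: cy|exact: ccos].
  by apply: cvgM; [exact: cv|apply: cvgM; [exact: cvg_cst|exact: csin]].
have cB : {within `[0, l], continuous B}.
  move=> t; apply: cvgD; first by apply: cvgM; [exact: cy|exact: csin].
  by apply: cvgM; [exact: cv|apply: cvgM; [exact: cvg_cst|exact: ccos]].
have ycs (t : R) : y t = A t * cos (s * t) + B t * sin (s * t).
  have := cos2Dsin2 (s * t); rewrite /A /B.
  move: (cos _) (sin _) => co si cs; apply/eqP; rewrite -subr_eq0; apply/eqP.
  by transitivity (y t * (1 - (co ^+ 2 + si ^+ 2))); [ring|rewrite cs; ring].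
have vcs (t : R) : v t / s = B t * cos (s * t) - A t * sin (s * t).
  have := cos2Dsin2 (s * t); rewrite /A /B.
  move: (cos _) (sin _) => co si cs; apply/eqP; rewrite -subr_eq0; apply/eqP.
  by transitivity (v t / s * (1 - (co ^+ 2 + si ^+ 2))); [ring|rewrite cs; ring].
have A0 : A 0 = y 0 by rewrite /A mulr0 cos0 sin0; ring.
have B0 : B 0 = dy 0 / s by rewrite /B mulr0 cos0 sin0 v0; ring.
have Y0 : 0 <= Y by rewrite /Y.
have Q0 : 0 <= Q by apply: le_trans (qtQ 0 _) => //; rewrite lexx.
have e0 : 0 <= e.
  by rewrite -lee_fin; apply: le_trans qe; exact: integral_ge0.
have d0 : 0 <= d by rewrite /d mulr_ge0 // addr_ge0 // divr_ge0 // ltW.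
have trig (a b co si : R) : `|co| <= 1 -> `|si| <= 1 -> `|a * co + b * si| <= `|a| + `|b|.
  move=> co1 si1; rewrite (le_trans (ler_normD _ _)) // lerD // normrM.
    by rewrite ler_piMr.
  by rewrite ler_piMr.
have qy (t : R) : 0 <= t <= l -> `|s^-1 * (qt t * y t)| <= Q / s * Y.
  move=> tl; rewrite !normrM normfV (gtr0_norm s0) mulrCA mulrA.
  by apply: ler_pM; rewrite ?mulr_ge0 ?invr_ge0 ?(ltW s0) // ?cmax // ler_pM2r ?invr_gt0 // qtQ.
have A'M (t : R) : 0 <= t <= l -> `|A' t| <= (e + Q / s) * Y.
  move=> tl; rewrite /A' -mulNr (le_trans (trig _ _ _ _ (cos_max _) (sin_max _))) //.
  by rewrite mulrDl lerD ?we // normrN qy.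
have B'M (t : R) : 0 <= t <= l -> `|B' t| <= (e + Q / s) * Y.
  move=> tl; rewrite /B' (le_trans (trig _ _ _ _ (sin_max _) (cos_max _))) //.
  by rewrite mulrDl lerD ?we // qy.
have AM (x : R) : 0 <= x <= l -> `|A x - A 0| <= d * Y.
  by move=> xl; have := mean_value_bound xl cA dA A'M; rewrite mulrAC.
have BM (x : R) : 0 <= x <= l -> `|B x - B 0| <= d * Y.
  by move=> xl; have := mean_value_bound xl cB dB B'M; rewrite mulrAC.
(* Half of the maximum is absorbed, as [2 * d <= 2^-1]. *)
have Yk : Y <= 2 * k.
  have h1 : Y <= `|A c| + `|B c|.
    by rewrite {1}/Y ycs; apply: trig; [exact: cos_max|exact: sin_max].
  have h2 : `|A c| <= `|y 0| + d * Y.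
    by rewrite -lerBlDl -A0 (le_trans (lerB_dist _ _)) // AM.
  have h3 : `|B c| <= `|dy 0| / s + d * Y.
    rewrite -lerBlDl -{1}(gtr0_norm s0) -normf_div -B0.
    by rewrite (le_trans (lerB_dist _ _)) // BM.
  have h4 : d * Y <= 4^-1 * Y by rewrite ler_wpM2r.
  by rewrite /k; lra.
have ll : 0 <= l <= l by rewrite l0' lexx.
have dYk : d * Y <= 2 * (d * k) by rewrite mulrCA ler_wpM2l.
have Al := AM _ ll; have Bl := BM _ ll.
split.
  have -> : y l - (y 0 * cos (s * l) + dy 0 / s * sin (s * l)) =
      (A l - A 0) * cos (s * l) + (B l - B 0) * sin (s * l).
    by rewrite ycs A0 B0; ring.
  apply: le_trans (trig _ _ _ _ (cos_max _) (sin_max _)) _.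
  by rewrite -mulrA; lra.
have -> : dy l / s - (dy 0 / s * cos (s * l) - y 0 * sin (s * l)) =
    (dy l - v l) / s + ((B l - B 0) * cos (s * l) + (- (A l - A 0)) * sin (s * l)).
  by rewrite mulrBl vcs A0 B0; ring.
apply: le_trans (ler_normD _ _) _; rewrite [leRHS]mulrDl [leRHS]addrC lerD //.
  rewrite normrM normfV (gtr0_norm s0).
  apply: (@le_trans _ _ (e * Y / s)).
    by rewrite ler_pM2r ?invr_gt0 // we.
  rewrite (_ : 2 * (e / s) * k = e * (2 * k) / s); last by ring.
  by rewrite ler_pM2r ?invr_gt0 // ler_wpM2l.
apply: le_trans (trig _ _ _ _ (cos_max _) (sin_max _)) _.
by rewrite normrN -mulrA; lra.
Qed.

End RealSchrodinger.

Section LargeFrequency.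
Variable R : realType.
Local Notation mu := (@lebesgue_measure R).

(** [|q| <= 1 + q ^ 2], and the segment has finite length. *)
Lemma L2_on_integrable (l : R) (q : R -> R) : L2_on l q ->
  mu.-integrable `[0, l] (EFin \o q).
Proof.
move=> [mq q2].
have h1 : mu.-integrable `[0, l] (EFin \o (fun t => 1 + q t ^+ 2)).
  have -> : EFin \o (fun t => 1 + q t ^+ 2) =
     ((EFin \o cst 1%R) \+ (fun t => (q t ^+ 2)%:E))%E.
    by apply/funext => t; rewrite /= EFinD.
  apply: integrableD => //; apply: integrable_within.
  by apply: continuous_subspaceT => t; exact: cst_continuous.
apply: le_integrable h1 => //; first exact/measurable_EFinP.
move=> t _ /=; rewrite lee_fin [leRHS]ger0_norm; last by rewrite addr_ge0 ?sqr_ge0.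
have := sqr_ge0 (`|q t| - 2^-1); rewrite sqrrB real_normK ?num_real //.
by move: (q t ^+ 2) => a; lra.
Qed.

(** Continuous functions are dense in L^1, so [e] in [free_comparison] can be
taken as small as needed, at the price of a large bound [Q]; a large frequency
compensates for [Q]. *)
Lemma free_asymptotics (l : R) (q : R -> R) (eta : R) : 0 < l -> L2_on l q ->
  0 < eta -> exists2 s0 : R, 0 < s0 &
  forall s y dy, s0 <= s -> real_solution l q s y dy ->
  let k := `|y 0| + `|dy 0| / s in
  `|y l - (y 0 * cos (s * l) + dy 0 / s * sin (s * l))| <= eta * k /\
  `|dy l / s - (dy 0 / s * cos (s * l) - y 0 * sin (s * l))| <= eta * k.
Proof.
move=> l0 /L2_on_integrable qi eta0.
(* [4 * del + 2 * (eta / 4) <= eta], and [del] meets the bound on [d] in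
[free_comparison]. *)
pose del : R := Num.min 4^-1 (eta / 8).
have del0 : 0 < del by rewrite lt_min invr_gt0 ltr0n divr_gt0.
pose e : R := Num.min 1 (del / (2 * l)).
have e0 : 0 < e by rewrite lt_min ltr01 divr_gt0 // mulr_gt0.
have [|h_ [ch hi hq]] := approximation_continuous_integrable (measurable_itv `[0, l]) _ qi.
  by rewrite /= lebesgue_measure_itv /= lte_fin l0 ltry.
have [n qh] : exists n, (\int[mu]_(t in `[0%R, l]) `|(q t - h_ n t)%:E| <= e%:E)%E.
  have [N _ /(_ N (leqnn N)) /= /ltW] := hq _ (@nbhs_open_ereal_lt R 0 (fun=> e) e0).
  by exists N.
have [c cl cmax] := within_continuous_bounded (ltW l0)
   (continuous_subspaceT (ch n)).
set Q := `|_| in cmax.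
have Q0 : 0 <= Q by rewrite /Q.
exists (4 / eta + 2 * Q * l / del).
  by rewrite ltr_wpDr ?divr_gt0 // divr_ge0 ?mulr_ge0 // ltW.
move=> s y dy ss sol k.
have s0 : 0 < s.
  by apply: lt_le_trans ss; rewrite ltr_wpDr ?divr_gt0 // divr_ge0 ?mulr_ge0 // ltW.
have k0 : 0 <= k by rewrite addr_ge0 // divr_ge0 // ltW.
have el : e * l <= del / 2.
  have : e <= del / (2 * l) by rewrite ge_min lexx orbT.
  rewrite ler_pdivlMr ?mulr_gt0 // => h; lra.
have Ql : Q / s * l <= del / 2.
  have : 2 * Q * l / del <= s by apply: le_trans ss; rewrite lerDr divr_ge0 // ltW.
  rewrite ler_pdivrMr // => h.
  by rewrite mulrAC ler_pdivrMr //; lra.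
have es : e / s <= eta / 4.
  have e1 : e <= 1 by rewrite ge_min lexx.
  have : 4 / eta <= s by apply: le_trans ss; rewrite lerDl divr_ge0 ?mulr_ge0 // ltW.
  rewrite ler_pdivrMr // => h.
  by rewrite ler_pdivrMr //; lra.
have d4 : del <= 4^-1 by rewrite ge_min lexx.
have d8 : del <= eta / 8 by rewrite ge_min lexx orbT.
have [] := free_comparison l0 s0 qi (ch n) cmax qh sol.
  by rewrite mulrDl; lra.
move=> h1 h2; split; [apply: le_trans h1 _|apply: le_trans h2 _].
  by rewrite ler_wpM2r //; lra.
by rewrite ler_wpM2r //; lra.
Qed.

End LargeFrequency.

(** * Complex-valued functions *)

Section ComplexNumbers.
Variable R : realType.
Local Notation K := (Cx R).
Implicit Types (z w : K) (x y : R).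

Lemma reC_is_zmod_morphism : zmod_morphism (@reC R).
Proof. by move=> [a b] [c d]. Qed.

Lemma imC_is_zmod_morphism : zmod_morphism (@imC R).
Proof. by move=> [a b] [c d]. Qed.

Lemma mkC_eta z : mkC (reC z) (imC z) = z.
Proof. by case: z. Qed.

Lemma mkCM x y x' y' : mkC x y * mkC x' y' = mkC (x * x' - y * y') (x * y' + y * x').
Proof. by []. Qed.

Lemma ofR_is_zmod_morphism : zmod_morphism (@ofR R).
Proof. exact: raddfB. Qed.

Lemma ofR_is_monoid_morphism : monoid_morphism (@ofR R).
Proof. by split=> [|x y]; [exact: rmorph1|exact: rmorphM]. Qed.

HB.instance Definition _ := GRing.isZmodMorphism.Build R K (@ofR R) ofR_is_zmod_morphism.
HB.instance Definition _ :=
  GRing.isMonoidMorphism.Build R K (@ofR R) ofR_is_monoid_morphism.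
HB.instance Definition _ := GRing.isZmodMorphism.Build K R (@reC R) reC_is_zmod_morphism.
HB.instance Definition _ := GRing.isZmodMorphism.Build K R (@imC R) imC_is_zmod_morphism.

Lemma reC_ofRM x z : reC (ofR x * z) = x * reC z.
Proof. by case: z => a b; rewrite /reC /ofR /= mul0r subr0. Qed.

Lemma imC_ofRM x z : imC (ofR x * z) = x * imC z.
Proof. by case: z => a b; rewrite /imC /ofR /= mul0r addr0. Qed.

Lemma ofR_pos (e : K) : 0 < e -> exists2 x, 0 < x & e = ofR x.
Proof.
case: e => a b; rewrite ltcE /= => /andP[/eqP -> a0].
by exists a.
Qed.

Lemma normC_ofR x : `|ofR x| = ofR `|x|.
Proof. by rewrite normc_def /= expr0n addr0 sqrtr_sqr. Qed.

Lemma continuous_ofR : continuous (@ofR R).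
Proof.
move=> x; apply/cvgrPdist_lt => e /ofR_pos[e' e0 ->].
near=> y; rewrite -raddfB normC_ofR /ofR ltcR.
by near: y; apply: cvgr_dist_lt.
Unshelve. all: by end_near. Qed.

Lemma near_distC z x : 0 < x -> \forall w \near z, `|z - w| < ofR x.
Proof.
move=> x0; have ox : 0 < ofR x by rewrite -[0]/(ofR 0) /ofR ltcR.
by have /cvgrPdist_lt/(_ (ofR x) ox) := @cvg_id K (nbhs z).
Qed.

Lemma continuous_reC : continuous (@reC R).
Proof.
move=> z; apply/(@cvgrPdist_lt _ R K (nbhs z) (nbhs_filter z)) => e e0.
near=> w; rewrite -raddfB -ltcR (le_lt_trans (normc_ge_Re (z - w))) //.
by near: w; exact: near_distC.
Unshelve. all: by end_near. Qed.

Lemma continuous_imC : continuous (@imC R).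
Proof.
move=> z; apply/(@cvgrPdist_lt _ R K (nbhs z) (nbhs_filter z)) => e e0.
have imE u : imC u = - reC (u * 'i%C) by rewrite /reC ReiNIm opprK.
near=> w; rewrite -raddfB /= imE normrN -ltcR (le_lt_trans (normc_ge_Re _)) // normrM.
rewrite (_ : `|'i%C| = 1) ?mulr1; last first.
  by rewrite normc_def /= expr0n expr1n add0r sqrtr1.
by near: w; exact: near_distC.
Unshelve. all: by end_near. Qed.

Lemma solves_real (l : R) (q : R -> R) (s : R) (y dy : R -> K) :
  solves l q (ofR s ^+ 2) y dy ->
  real_solution l q s (@reC R \o y) (@reC R \o dy) /\
  real_solution l q s (@imC R \o y) (@imC R \o dy).
Proof.
move=> [cy cdy yE dyE].
have ccomp (f : K -> R) (h : R -> K) : continuous f ->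
    {within `[0, l], continuous h} -> {within `[0, l], continuous (f \o h)}.
  move=> cf ch t. apply: (@continuous_comp (subspace `[0, l]) K R h f t).
    exact: (ch t).
  exact: (cf (h t)).
have coef t : ofR (q t) - ofR s ^+ 2 = ofR (q t - s ^+ 2).
  by rewrite rmorphB rmorphXn.
split; split; try (apply: ccomp => //; first [exact: continuous_reC|exact: continuous_imC]).
- by move=> x xl; rewrite /= yE // raddfD.
- move=> x xl; rewrite /= dyE // raddfD /=; congr (_ + _).
  by apply: eq_Rintegral => t _; rewrite coef reC_ofRM.
- by move=> x xl; rewrite /= yE // raddfD.
- move=> x xl; rewrite /= dyE // raddfD /=; congr (_ + _).
  by apply: eq_Rintegral => t _; rewrite coef imC_ofRM.
Qed.

End ComplexNumbers.

(** * High-frequency limits of the determinants *)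

Section HighFrequencyDeterminants.
Variable R : realType.
Local Notation K := (Cx R).

(** The frequency being real, the real and imaginary parts are solutions; with
real initial data the imaginary part has zero data, and [free_asymptotics]
forces it to vanish at the end point. *)
Lemma solves_asymptotics (l : R) (q : R -> R) (eta : R) : 0 < l -> L2_on l q ->
  0 < eta -> exists2 s0 : R, 0 < s0 &
  forall (s : R) (y dy : R -> K) (a b : R), s0 <= s ->
  solves l q (ofR s ^+ 2) y dy -> y 0 = ofR a -> dy 0 = ofR b ->
  let k := `|a| + `|b| / s in
  `|y l - ofR (a * cos (s * l) + b / s * sin (s * l))| <= ofR (eta * k) /\
  `|dy l / ofR s - ofR (b / s * cos (s * l) - a * sin (s * l))|
     <= ofR (eta * k).
Proof.
move=> l0 qL eta0; have [s0 s0_gt0 hs] := free_asymptotics l0 qL eta0.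
exists s0 => // s y dy a b ss sol ya dyb k.
have s_gt0 := lt_le_trans s0_gt0 ss.
have [/(hs _ _ _ ss) [h1 h2] /(hs _ _ _ ss) [h3 h4]] := solves_real sol.
move: h1 h2 h3 h4; rewrite /= ya dyb.
have [-> ->] : (reC (ofR a) = a) * (imC (ofR a) = 0) by [].
have [-> ->] : (reC (ofR b) = b) * (imC (ofR b) = 0) by [].
rewrite normr0 !mul0r !addr0 !mulr0 !subr0 => h1 h2.
rewrite normr_le0 => /eqP im1; rewrite normr_le0 mulf_eq0 invr_eq0 (gt_eqF s_gt0) orbF.
move=> /eqP im2.
split.
  have -> : y l = ofR (reC (y l)) by rewrite -[LHS]mkC_eta im1.
  by rewrite -raddfB normC_ofR /ofR lecR.
have -> : dy l = ofR (reC (dy l)) by rewrite -[LHS]mkC_eta im2.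
by rewrite -fmorph_div -raddfB normC_ofR /ofR lecR.
Qed.

Lemma cvg_det n (A : nat -> 'M[K]_n) (B : 'M[K]_n) :
  (forall i j, A m i j @[m --> \oo] --> B i j) ->
  \det (A m) @[m --> \oo] --> \det B.
Proof.
move=> AB; rewrite /determinant.
have csum (I : Type) (r : seq I) (F : I -> nat -> K) (G : I -> K) :
    (forall i, F i m @[m --> \oo] --> G i) ->
    \sum_(i <- r) F i m @[m --> \oo] --> \sum_(i <- r) G i.
  move=> FG; elim: r => [|i r IH].
    by rewrite big_nil; under eq_fun do rewrite big_nil; exact: cvg_cst.
  rewrite big_cons (_ : (fun m => _) = (fun m => F i m + \sum_(i <- r) F i m)).
    exact: (cvgD (FG i) IH).
  by apply/funext => m; rewrite big_cons.
have cprod (I : Type) (r : seq I) (F : I -> nat -> K) (G : I -> K) :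
    (forall i, F i m @[m --> \oo] --> G i) ->
    \prod_(i <- r) F i m @[m --> \oo] --> \prod_(i <- r) G i.
  move=> FG; elim: r => [|i r IH].
    by rewrite big_nil; under eq_fun do rewrite big_nil; exact: cvg_cst.
  rewrite big_cons (_ : (fun m => _) = (fun m => F i m * \prod_(i <- r) F i m)).
    exact: (cvgM (FG i) IH).
  by apply/funext => m; rewrite big_cons.
by apply: csum => s; apply: cvgM; [exact: cvg_cst|apply: cprod => i; exact: AB].
Qed.

Variables (g : nat) (T : rooted_tree g).

Lemma cvg_det_system root_row (c dc s ds : nat -> 'I_g -> K)
    (c0 dc0 s0 ds0 : 'I_g -> K) l l' (lam : nat -> K) lam' :
  (forall j, c m j @[m --> \oo] --> c0 j) ->
  (forall j, dc m j @[m --> \oo] --> dc0 j) ->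
  (forall j, s m j @[m --> \oo] --> s0 j) ->
  (forall j, ds m j @[m --> \oo] --> ds0 j) ->
  \det (system_mx T root_row (const_family (c m) (dc m) (s m) (ds m)) l (lam m))
    @[m --> \oo] -->
  \det (system_mx T root_row (const_family c0 dc0 s0 ds0) l' lam').
Proof.
move=> cc cdc cs cds; apply: cvg_det => i j.
rewrite /system_mx; case: (split_ordP i) => i' ->.
  rewrite col_mxEu !mxE; under eq_fun do rewrite col_mxEu !mxE.
  case: ifP => _; first exact: cvg_cst.
  rewrite /row_continuity; case: (split_ordP j) => j' ->.
    rewrite row_mxEl mxE; under eq_fun do rewrite row_mxEl mxE.
    by apply: cvgB; [apply: cvgM; [exact: cvg_cst|exact: cc]|exact: cvg_cst].
  rewrite row_mxEr mxE; under eq_fun do rewrite row_mxEr mxE.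
  by apply: cvgM; [exact: cvg_cst|exact: cs].
rewrite col_mxEd mxE; under eq_fun do rewrite col_mxEd mxE.
rewrite /row_kirchhoff; case: (split_ordP j) => j' ->.
  rewrite row_mxEl mxE; under eq_fun do rewrite row_mxEl mxE.
  by apply: cvgM; [exact: cvg_cst|exact: cdc].
rewrite row_mxEr mxE; under eq_fun do rewrite row_mxEr mxE.
by apply: cvgB; [apply: cvgM; [exact: cvg_cst|exact: cds]|exact: cvg_cst].
Qed.

Section AlongSequence.
Variables (l : R) (q : 'I_g -> R -> R) (u : fundamental_family R g).
Hypotheses (l0 : 0 < l) (hq : forall j, L2_on l (q j)) (hu : is_fundamental l q u).
Variables (w : nat -> R) (C S : R).
Hypotheses (wy : w m @[m --> \oo] --> +oo)
  (wC : forall m, cos (w m * l) = C) (wS : forall m, sin (w m * l) = S).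

Lemma cvg_fundamental j :
  [/\ fc u j (ofR (w m) ^+ 2) l @[m --> \oo] --> ofR C,
      dfc u j (ofR (w m) ^+ 2) l / ofR (w m) @[m --> \oo] --> - ofR S,
      ofR (w m) * fs u j (ofR (w m) ^+ 2) l @[m --> \oo] --> ofR S
    & Defs.dfs u j (ofR (w m) ^+ 2) l @[m --> \oo] --> ofR C].
Proof.
have key (e : R) : 0 < e -> \forall m \near \oo,
   [/\ `|fc u j (ofR (w m) ^+ 2) l - ofR C| <= ofR e,
       `|dfc u j (ofR (w m) ^+ 2) l / ofR (w m) - - ofR S| <= ofR e,
       `|ofR (w m) * fs u j (ofR (w m) ^+ 2) l - ofR S| <= ofR e
     & `|Defs.dfs u j (ofR (w m) ^+ 2) l - ofR C| <= ofR e].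
  move=> e0; have [s0 s0_gt0 hs] := solves_asymptotics l0 (hq j) e0.
  near=> m; have ws : s0 <= w m by near: m; move/cvgryPge: wy; exact.
  have w0 := lt_le_trans s0_gt0 ws.
  have [csol [c0 dc0] ssol [ss0 ds0]] := hu j (ofR (w m) ^+ 2).
  have [] := hs _ _ _ 1 0 ws csol c0 dc0.
  have [] := hs _ _ _ 0 1 ws ssol ss0 ds0.
  rewrite normr1 normr0 !mul0r !add0r !mul1r subr0 wC wS !addr0.
  rewrite !mulr1 => h1 h2 h3 h4.
  have wK : ofR (w m) != 0 by rewrite fmorph_eq0 gt_eqF.
  have scale (z : K) (x : R) : `|z - ofR ((w m)^-1 * x)| <= ofR (e / w m) ->
      `|ofR (w m) * z - ofR x| <= ofR e.
    have -> : ofR (w m) * z - ofR x = ofR (w m) * (z - ofR ((w m)^-1 * x)).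
      by rewrite mulrBr -rmorphM mulrA mulfV ?mul1r // gt_eqF.
    rewrite normrM normC_ofR (gtr0_norm w0) => h.
    have -> : ofR e = ofR (w m) * ofR (e / w m).
      by rewrite -rmorphM mulrC divfK // gt_eqF.
    by rewrite ler_pM2l // /ofR -[0]/(0%:C)%C ltcR.
  split => //; first by move: h4; rewrite raddfN.
    exact: scale h1.
  by have := scale _ _ h2; rewrite mulrC divfK.
have lim (f : nat -> K) (z : K) : (forall e : R, 0 < e ->
    \forall m \near \oo, `|f m - z| <= ofR e) -> f m @[m --> \oo] --> z.
  by move=> h; apply/cvgrPdistC_le => ep /ofR_pos[e e0 ->]; exact: h.
by split; apply: lim => e e0; apply: filterS (key e e0) => m [].
Unshelve. all: by end_near. Qed.

(** Along [w] the phases at the end points are constant, so the rescaled system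
has a limit, the one of constant coefficients. *)
Lemma cvg_det_Phi_D : C ^+ 2 + S ^+ 2 = 1 ->
  \det (Phi_D T u l (ofR (w m) ^+ 2)) @[m --> \oo] -->
  (-1) ^+ vdeg (tadj T) ord0 * (psi_hat K T).[ofR C].
Proof.
move=> CS; have CS' : ofR C ^+ 2 + ofR S ^+ 2 = 1.
  by rewrite -!rmorphXn -raddfD /= CS rmorph1.
rewrite -(det_Phi_D_uniform T l 0 CS').
pose D m := \det (Phi_D T (const_family
  (fun j => fc u j (ofR (w m) ^+ 2) l)
  (fun j => dfc u j (ofR (w m) ^+ 2) l / ofR (w m))
  (fun j => ofR (w m) * fs u j (ofR (w m) ^+ 2) l)
  (fun j => Defs.dfs u j (ofR (w m) ^+ 2) l)) l (ofR (w m) ^+ 2)).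
have DE : \forall m \near \oo, D m = \det (Phi_D T u l (ofR (w m) ^+ 2)).
  near=> m; rewrite /D -det_Phi_D_scale //.
  rewrite fmorph_eq0 gt_eqF //.
  by near: m; move/cvgryPgt: wy; exact.
apply: cvg_trans (near_eq_cvg DE) _.
apply: (@cvg_det_system (row_dirichlet R (g := g)) (fun m j => fc u j (ofR (w m) ^+ 2) l)
  (fun m j => dfc u j (ofR (w m) ^+ 2) l / ofR (w m))
  (fun m j => ofR (w m) * fs u j (ofR (w m) ^+ 2) l)
  (fun m j => Defs.dfs u j (ofR (w m) ^+ 2) l)
  (fun=> ofR C) (fun=> - ofR S) (fun=> ofR S) (fun=> ofR C)
  l l (fun m => ofR (w m) ^+ 2) 0) => j.
- by have [h _ _ _] := cvg_fundamental j; exact: h.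
- by have [_ h _ _] := cvg_fundamental j; exact: h.
- by have [_ _ h _] := cvg_fundamental j; exact: h.
- by have [_ _ _ h] := cvg_fundamental j; exact: h.
Unshelve. all: by end_near. Qed.

Lemma cvg_det_Phi_N : (0 < g)%N -> C ^+ 2 + S ^+ 2 = 1 -> S != 0 ->
  ofR S / ofR (w m) * \det (Phi_N T u l (ofR (w m) ^+ 2)) @[m --> \oo] -->
  (-1) ^+ vdeg (tadj T) ord0 * (psi K T).[ofR C].
Proof.
move=> g0 CS S0; have CS' : ofR C ^+ 2 + ofR S ^+ 2 = 1.
  by rewrite -!rmorphXn -raddfD /= CS rmorph1.
have S0' : ofR S != 0 by rewrite fmorph_eq0.
rewrite -(det_Phi_N_uniform T l 0 g0 S0' CS').
pose D m := ofR S * \det (Phi_N T (const_family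
  (fun j => fc u j (ofR (w m) ^+ 2) l)
  (fun j => dfc u j (ofR (w m) ^+ 2) l / ofR (w m))
  (fun j => ofR (w m) * fs u j (ofR (w m) ^+ 2) l)
  (fun j => Defs.dfs u j (ofR (w m) ^+ 2) l)) l (ofR (w m) ^+ 2)).
have DE : \forall m \near \oo,
    D m = ofR S / ofR (w m) * \det (Phi_N T u l (ofR (w m) ^+ 2)).
  near=> m; have wm : ofR (w m) != 0.
    rewrite fmorph_eq0 gt_eqF //.
    by near: m; move/cvgryPgt: wy; exact.
  rewrite -[Phi_N T u l _]/(Phi_N T (const_family
    (fun j => fc u j (ofR (w m) ^+ 2) l) (fun j => dfc u j (ofR (w m) ^+ 2) l)
    (fun j => fs u j (ofR (w m) ^+ 2) l) (fun j => Defs.dfs u j (ofR (w m) ^+ 2) l))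
    l (ofR (w m) ^+ 2)).
  by rewrite (det_Phi_N_scale _ _ _ _ _ _ _ g0 wm) mulrA divfK.
apply: cvg_trans (near_eq_cvg DE) _.
apply: cvgM; first exact: cvg_cst.
apply: (@cvg_det_system (row_standard R T) (fun m j => fc u j (ofR (w m) ^+ 2) l)
  (fun m j => dfc u j (ofR (w m) ^+ 2) l / ofR (w m))
  (fun m j => ofR (w m) * fs u j (ofR (w m) ^+ 2) l)
  (fun m j => Defs.dfs u j (ofR (w m) ^+ 2) l)
  (fun=> ofR C) (fun=> - ofR S) (fun=> ofR S) (fun=> ofR C)
  l l (fun m => ofR (w m) ^+ 2) 0) => j.
- by have [h _ _ _] := cvg_fundamental j; exact: h.
- by have [_ h _ _] := cvg_fundamental j; exact: h.
- by have [_ _ h _] := cvg_fundamental j; exact: h.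
- by have [_ _ _ h] := cvg_fundamental j; exact: h.
Unshelve. all: by end_near. Qed.

End AlongSequence.

End HighFrequencyDeterminants.

(** * The zero potential: uniqueness *)

Section ZeroPotential.
Variable R : realType.
Local Notation K := (Cx R).
Local Notation mu := (@lebesgue_measure R).
Implicit Types (y dy f df F : R -> K) (lam : K) (x t l : R).

(** Componentwise, so that the calculus of real functions applies. *)
Definition is_Cderive (f f' : R -> K) (x : R) :=
  is_derive x 1 (fun t => reC (f t)) (reC (f' x)) /\
  is_derive x 1 (fun t => imC (f t)) (imC (f' x)).

Lemma reCD (z w : K) : reC (z + w) = reC z + reC w.
Proof. exact: raddfD. Qed.

Lemma imCD (z w : K) : imC (z + w) = imC z + imC w.
Proof. exact: raddfD. Qed.

Lemma reCM (z w : K) : reC (z * w) = reC z * reC w - imC z * imC w.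
Proof. by case: z; case: w. Qed.

Lemma imCM (z w : K) : imC (z * w) = reC z * imC w + imC z * reC w.
Proof. by case: z; case: w. Qed.

Lemma is_CderiveM (f f' F F' : R -> K) x : is_Cderive f f' x -> is_Cderive F F' x ->
  is_Cderive (fun t => f t * F t) (fun t => f' t * F t + f t * F' t) x.
Proof.
move=> [fr fi] [Fr Fi]; split.
  have -> : (fun t => reC (f t * F t)) =
      (fun t => reC (f t) * reC (F t) - imC (f t) * imC (F t)).
    by apply/funext => t; rewrite reCM.
  apply: is_derive_eq (is_deriveB _ _) _.
  by rewrite /GRing.scale /= reCD !reCM; ring.
have -> : (fun t => imC (f t * F t)) =
    (fun t => reC (f t) * imC (F t) + imC (f t) * reC (F t)).
  by apply/funext => t; rewrite imCM.
apply: is_derive_eq (is_deriveD _ _) _.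
by rewrite /GRing.scale /= imCD !imCM; ring.
Qed.

Lemma is_CderiveB (f f' F F' : R -> K) x : is_Cderive f f' x -> is_Cderive F F' x ->
  is_Cderive (fun t => f t - F t) (fun t => f' t - F' t) x.
Proof.
move=> [fr fi] [Fr Fi]; split.
  have -> : (fun t => reC (f t - F t)) = (fun t => reC (f t) - reC (F t)).
    by apply/funext => t; rewrite raddfB.
  by rewrite raddfB; exact: is_deriveB.
have -> : (fun t => imC (f t - F t)) = (fun t => imC (f t) - imC (F t)).
  by apply/funext => t; rewrite raddfB.
by rewrite raddfB; exact: is_deriveB.
Qed.

Lemma is_Cderive_cst (k : K) x : is_Cderive (fun=> k) (fun=> 0) x.
Proof. by split; rewrite raddf0; exact: is_derive_cst. Qed.

Lemma is_CderiveZ (k : K) (f f' : R -> K) x : is_Cderive f f' x ->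
  is_Cderive (fun t => k * f t) (fun t => k * f' t) x.
Proof.
move=> /(is_CderiveM (is_Cderive_cst k x)).
by rewrite /is_Cderive mul0r add0r.
Qed.

Lemma is_Cderive_eq (f f' f'' : R -> K) x : is_Cderive f f' x -> f' x = f'' x ->
  is_Cderive f f'' x.
Proof. by rewrite /is_Cderive => + <-. Qed.

Lemma within_continuousC l f :
  {within `[0, l], continuous f} ->
  {within `[0, l], continuous (fun t => reC (f t))} /\
  {within `[0, l], continuous (fun t => imC (f t))}.
Proof.
move=> cf; split => t; apply: (@continuous_comp (subspace `[0, l]) K R f _ t).
- exact: (cf t).
- exact: (@continuous_reC R (f t)).
- exact: (cf t).
- exact: (@continuous_imC R (f t)).
Qed.

Lemma Cprimitive_derive l f F x : {within `[0, l], continuous f} ->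
  (forall t, 0 <= t <= l -> F t = F 0 + Cintegral t f) ->
  0 < x < l -> is_Cderive F f x.
Proof.
move=> /within_continuousC[cr ci] FE xl.
split.
  by apply: (is_derive_primitive cr _ xl) => t tl; rewrite FE // reCD.
by apply: (is_derive_primitive ci _ xl) => t tl; rewrite FE // imCD.
Qed.

Lemma Cconstant l F x : 0 <= x <= l -> {within `[0, l], continuous F} ->
  (forall t, 0 < t < l -> is_Cderive F (fun=> 0) t) -> F x = F 0.
Proof.
move=> xl /within_continuousC[cr ci] dF.
have zero (h : R -> R) : {within `[0, l], continuous h} ->
    (forall t, 0 < t < l -> is_derive t 1 h 0) -> h x = h 0.
  move=> ch dh; apply/eqP; rewrite -subr_eq0 -normr_le0 -[leRHS](mul0r l).
  have bnd (t : R) : 0 <= t <= l -> `|(fun=> 0 : R) t| <= 0 by rewrite normr0.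
  exact: mean_value_bound xl ch dh bnd.
rewrite -[LHS]mkC_eta -[RHS]mkC_eta; congr mkC.
  by apply: (zero _ cr) => t /dF[]; rewrite raddf0.
by apply: (zero _ ci) => t /dF[_]; rewrite raddf0.
Qed.

Local Notation q0 := (fun _ : R => 0 : R).

Lemma wronskian_constant l lam y dy f df x : 0 <= x <= l ->
  solves l q0 lam y dy -> solves l q0 lam f df ->
  y x * df x - dy x * f x = y 0 * df 0 - dy 0 * f 0.
Proof.
move=> xl [cy cdy yE dyE] [cf cdf fE dfE].
pose W t := y t * df t - dy t * f t; rewrite -!/(W _).
have cM (g h : R -> K) : {within `[0, l], continuous g} ->
    {within `[0, l], continuous h} -> {within `[0, l], continuous (fun t => g t * h t)}.
  by move=> cg ch t; apply: cvgM; [exact: cg|exact: ch].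
have c0 (g : R -> K) : {within `[0, l], continuous g} ->
    {within `[0, l], continuous (fun t => (ofR 0 - lam) * g t)}.
  by move=> cg t; apply: cvgM; [exact: cvg_cst|exact: cg].
apply: (Cconstant xl).
  by move=> t; apply: cvgB; exact: cM.
move=> t tl.
have dyt := Cprimitive_derive cdy yE tl.
have ddyt := Cprimitive_derive (c0 _ cy) dyE tl.
have dft := Cprimitive_derive cdf fE tl.
have ddft := Cprimitive_derive (c0 _ cf) dfE tl.
apply: is_Cderive_eq (is_CderiveB (is_CderiveM dyt ddft) (is_CderiveM ddyt dft)) _.
by ring.
Qed.

(** The Wronskians of [y] with [s] and [c] are its initial data up to sign, and
that of [c] with [s] is 1; solve for [y l] and [dy l]. *)
Lemma solves_wronskian_basis l lam (c dc s ds y dy : R -> K) : 0 <= l ->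
  solves l q0 lam c dc -> solves l q0 lam s ds -> solves l q0 lam y dy ->
  c 0 = 1 -> dc 0 = 0 -> s 0 = 0 -> ds 0 = 1 ->
  y l = y 0 * c l + dy 0 * s l /\ dy l = y 0 * dc l + dy 0 * ds l.
Proof.
move=> l0 sc ss sy c0 dc0 s0 ds0; have ll : 0 <= l <= l by rewrite l0 lexx.
have := wronskian_constant ll sc ss; have := wronskian_constant ll sy sc.
have := wronskian_constant ll sy ss; rewrite c0 dc0 s0 ds0 => e1 e2 e3.
split.
  transitivity (c l * (y l * ds l - dy l * s l) - s l * (y l * dc l - dy l * c l)
     + y l * (1 - (c l * ds l - dc l * s l))); first by ring.
  by rewrite e1 e2 e3; ring.
transitivity (dc l * (y l * ds l - dy l * s l) - ds l * (y l * dc l - dy l * c l)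
   + dy l * (1 - (c l * ds l - dc l * s l))); first by ring.
by rewrite e1 e2 e3; ring.
Qed.

Lemma is_Cderive_continuous f df : (forall x, is_Cderive f df x) -> continuous f.
Proof.
move=> fdf x; have -> : f = (fun t => ofR (reC (f t)) + 'i%C * ofR (imC (f t))).
  by apply/funext => t; exact: (complexE (f t)).
have ch (h : R -> R) (d : R) : is_derive x 1 h d -> ofR (h t) @[t --> x] --> ofR (h x).
  move=> [dh _]; apply: (@continuous_comp R R K h (@ofR R) x).
    exact/differentiable_continuous/derivable1_diffP.
  exact: continuous_ofR.
have [dr di] := fdf x.
by apply: cvgD; [exact: ch dr|apply: cvgM; [exact: cvg_cst|exact: ch di]].
Qed.

Lemma Cintegral_derive f df ddf x : 0 <= x -> (forall t, is_Cderive f df t) ->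
  (forall t, is_Cderive df ddf t) -> f x = f 0 + Cintegral x df.
Proof.
rewrite le_eqVlt => /predU1P[<- _ _|x0 dF ddF].
  by rewrite /Cintegral set_itv1 !Rintegral_set1 (_ : mkC 0 0 = 0 :> K) ?addr0.
have FTC (h dh : R -> R) : (forall t, is_derive t 1 h (dh t)) ->
    {within `[0, x], continuous dh} -> \int[mu]_(t in `[0, x]) dh t = h x - h 0.
  move=> hdh cdh; rewrite /Rintegral (@continuous_FTC2 _ dh h) //.
    have ch t : {for t, continuous h}.
      by apply/differentiable_continuous/derivable1_diffP; have [] := hdh t.
    split; first by move=> t _; have [] := hdh t.
      by apply: cvg_at_right_filter; exact: ch.
    by apply: cvg_at_left_filter; exact: ch.
  by move=> t _; rewrite derive1E; have [_ ->] := hdh t.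
have [cr ci] := within_continuousC (continuous_subspaceT (is_Cderive_continuous ddF)
  : {within `[0, x], continuous df}).
rewrite /Cintegral (FTC _ _ (fun t => (dF t).1) cr) (FTC _ _ (fun t => (dF t).2) ci).
rewrite (_ : mkC _ _ = f x - f 0); first by rewrite addrC subrK.
by case: (f x); case: (f 0).
Qed.

Lemma solves_classical l lam y dy :
  (forall x, is_Cderive y dy x) ->
  (forall x, is_Cderive dy (fun t => (ofR 0 - lam) * y t) x) ->
  solves l q0 lam y dy.
Proof.
move=> dY ddY; split.
- exact/continuous_subspaceT/(is_Cderive_continuous dY).
- exact/continuous_subspaceT/(is_Cderive_continuous ddY).
- by move=> x /andP[x0 _]; exact: Cintegral_derive dY ddY.
- move=> x /andP[x0 _]; apply: Cintegral_derive ddY _ => // t.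
  exact: is_CderiveZ (dY t).
Qed.

End ZeroPotential.

(** * The zero potential: trigonometric solutions *)

Section FreeSolutions.
Variable R : realType.
Local Notation K := (Cx R).
Local Notation q0 := (fun _ : R => 0 : R).
Implicit Types (s z : K) (x l : R).

Lemma coshR0 : coshR (0 : R) = 1.
Proof. by rewrite /coshR oppr0 expR0; field. Qed.

Lemma sinhR0 : sinhR (0 : R) = 0.
Proof. by rewrite /sinhR oppr0 expR0 subrr mul0r. Qed.

Lemma is_derive_expRM (b x : R) :
  is_derive x 1 (fun t => expR (b * t)) (b * expR (b * x)).
Proof.
have H := is_derive_mull b x.
by apply: is_derive_eq (is_derive1_comp _ _) _; rewrite mulrC.
Qed.

Lemma is_derive_coshM (b x : R) :
  is_derive x 1 (fun t => coshR (b * t)) (b * sinhR (b * x)).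
Proof.
(* [k] keeps the simplifications from unfolding the inverse of 2. *)
have [k kE] : exists k : R, k = 2^-1 by exists 2^-1.
have -> : (fun t => coshR (b * t)) =
    (fun t => k * (expR (b * t) + expR (- b * t))).
  by apply/funext => t; rewrite /coshR mulNr mulrC kE.
have e1 := is_derive_expRM b x; have e2 := is_derive_expRM (- b) x.
apply: is_derive_eq (is_deriveM (is_derive_cst _ _ _) (is_deriveD e1 e2)) _.
by rewrite /GRing.scale /= /sinhR !mulNr mulr0 addr0 -kE; ring.
Qed.

Lemma is_derive_sinhM (b x : R) :
  is_derive x 1 (fun t => sinhR (b * t)) (b * coshR (b * x)).
Proof.
(* [k] keeps the simplifications from unfolding the inverse of 2. *)
have [k kE] : exists k : R, k = 2^-1 by exists 2^-1.
have -> : (fun t => sinhR (b * t)) =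
    (fun t => k * (expR (b * t) - expR (- b * t))).
  by apply/funext => t; rewrite /sinhR mulNr mulrC kE.
have e1 := is_derive_expRM b x; have e2 := is_derive_expRM (- b) x.
apply: is_derive_eq (is_deriveM (is_derive_cst _ _ _) (is_deriveB e1 e2)) _.
by rewrite /GRing.scale /= /coshR !mulNr mulr0 addr0 -kE; ring.
Qed.

Lemma reC_MofR s x : reC (s * ofR x) = reC s * x.
Proof. by rewrite mulrC reC_ofRM mulrC. Qed.

Lemma imC_MofR s x : imC (s * ofR x) = imC s * x.
Proof. by rewrite mulrC imC_ofRM mulrC. Qed.

Lemma is_Cderive_Ccos s x : is_Cderive (fun t => Ccos (s * ofR t))
  (fun t => - s * Csin (s * ofR t)) x.
Proof.
have dc := is_derive_cosM (reC s) x; have ds := is_derive_sinM (reC s) x.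
have dC := is_derive_coshM (imC s) x; have dS := is_derive_sinhM (imC s) x.
have reN : reC (- s) = - reC s by exact: raddfN.
have imN : imC (- s) = - imC s by exact: raddfN.
split.
  have -> : (fun t => reC (Ccos (s * ofR t))) =
      (fun t => cos (reC s * t) * coshR (imC s * t)).
    by apply/funext => t; rewrite -reC_MofR -imC_MofR.
  apply: is_derive_eq (is_deriveM _ _) _.
  rewrite reCM reN imN {2}/reC {4}/imC /= reC_MofR imC_MofR /GRing.scale /=.
  by ring.
have -> : (fun t => imC (Ccos (s * ofR t))) =
    (fun t => - (sin (reC s * t) * sinhR (imC s * t))).
  by apply/funext => t; rewrite -reC_MofR -imC_MofR.
apply: is_derive_eq (is_deriveN (is_deriveM _ _)) _.
rewrite imCM reN imN {3}/reC {2}/imC /= reC_MofR imC_MofR /GRing.scale /=.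
by ring.
Qed.

Lemma is_Cderive_Csin s x : is_Cderive (fun t => Csin (s * ofR t))
  (fun t => s * Ccos (s * ofR t)) x.
Proof.
have dc := is_derive_cosM (reC s) x; have ds := is_derive_sinM (reC s) x.
have dC := is_derive_coshM (imC s) x; have dS := is_derive_sinhM (imC s) x.
split.
  have -> : (fun t => reC (Csin (s * ofR t))) =
      (fun t => sin (reC s * t) * coshR (imC s * t)).
    by apply/funext => t; rewrite -reC_MofR -imC_MofR.
  apply: is_derive_eq (is_deriveM _ _) _.
  rewrite reCM {2}/reC {4}/imC /= reC_MofR imC_MofR /GRing.scale /=.
  by ring.
have -> : (fun t => imC (Csin (s * ofR t))) =
    (fun t => cos (reC s * t) * sinhR (imC s * t)).
  by apply/funext => t; rewrite -reC_MofR -imC_MofR.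
apply: is_derive_eq (is_deriveM _ _) _.
rewrite imCM {3}/reC {2}/imC /= reC_MofR imC_MofR /GRing.scale /=.
by ring.
Qed.

Lemma Ccos0 : Ccos (0 : K) = 1.
Proof. by rewrite /Ccos /= cos0 sin0 coshR0 mul0r oppr0 mulr1. Qed.

Lemma Csin0 : Csin (0 : K) = 0.
Proof. by rewrite /Csin /= cos0 sin0 sinhR0 mulr0 mul0r. Qed.

Lemma Ccos_ofR x : Ccos (ofR x) = ofR (cos x).
Proof. by rewrite /Ccos /= coshR0 sinhR0 mulr1 mulr0 oppr0. Qed.

Lemma Csin_ofR x : Csin (ofR x) = ofR (sin x).
Proof. by rewrite /Csin /= coshR0 sinhR0 mulr1 mulr0. Qed.

Lemma Ccos2Dsin2 z : Ccos z ^+ 2 + Csin z ^+ 2 = 1.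
Proof.
have h1 := cos2Dsin2 (reC z).
have h2 : coshR (imC z) ^+ 2 - sinhR (imC z) ^+ 2 = 1.
  have e : expR (imC z) * expR (- imC z) = 1 by exact: expRxMexpNx_1.
  rewrite /coshR /sinhR; move: (expR _) (expR _) e => a b e.
  by field: e.
rewrite /Ccos /Csin !expr2 !mkCM.
move: (cos _) (sin _) (coshR _) (sinhR _) h1 h2 => c s C S h1 h2.
have s2 : s ^+ 2 = 1 - c ^+ 2 by rewrite -h1 addrAC subrr add0r.
have S2 : S ^+ 2 = C ^+ 2 - 1 by rewrite -h2 opprB addrC subrK.
transitivity (mkC 1 0 : K); last by [].
transitivity (mkC (c * C * (c * C) - - (s * S) * - (s * S) + (s * C * (s * C) - c * S * (c * S)))
  (c * C * - (s * S) + - (s * S) * (c * C) + (s * C * (c * S) + c * S * (s * C)))); first by [].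
by congr mkC; [ring: s2 S2|ring].
Qed.

Lemma solves_Ccos s l :
  solves l q0 (s ^+ 2) (fun t => Ccos (s * ofR t)) (fun t => - s * Csin (s * ofR t)).
Proof.
apply: solves_classical => x; first exact: is_Cderive_Ccos.
apply: is_Cderive_eq (is_CderiveZ (- s) (is_Cderive_Csin s x)) _.
by rewrite (raddf0 (@ofR R)) sub0r expr2; ring.
Qed.

Lemma solves_Csin s l : s != 0 ->
  solves l q0 (s ^+ 2) (fun t => s^-1 * Csin (s * ofR t)) (fun t => Ccos (s * ofR t)).
Proof.
move=> s0; apply: solves_classical => x.
  apply: is_Cderive_eq (is_CderiveZ (s^-1) (is_Cderive_Csin s x)) _.
  by rewrite mulKf.
apply: is_Cderive_eq (is_Cderive_Ccos s x) _.
by rewrite (raddf0 (@ofR R)) sub0r; field.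
Qed.

Lemma is_Cderive_ofR x : is_Cderive (@ofR R) (fun=> 1) x.
Proof. by split; [exact: is_derive_id|exact: is_derive_cst]. Qed.

(** The choice of the square root does not matter: the cosine is even, and so is
the sine divided by its argument. *)
Definition free_family (g : nat) : fundamental_family R g :=
  FundamentalFamily
    (fun _ lam t => if lam == 0 then 1 else Ccos (sqrtC lam * ofR t))
    (fun _ lam t => if lam == 0 then 0 else - sqrtC lam * Csin (sqrtC lam * ofR t))
    (fun _ lam t => if lam == 0 then ofR t else (sqrtC lam)^-1 * Csin (sqrtC lam * ofR t))
    (fun _ lam t => if lam == 0 then 1 else Ccos (sqrtC lam * ofR t)).

Lemma is_fundamental_free g l : is_fundamental l (fun _ => q0) (free_family g).
Proof.
move=> j lam; rewrite /free_family /=; case: eqP => [->|/eqP lam0].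
  split => //; apply: solves_classical => x.
  - exact: is_Cderive_cst.
  - by apply: is_Cderive_eq (is_Cderive_cst _ x) _; rewrite (raddf0 (@ofR R)); ring.
  - exact: is_Cderive_ofR.
  - by apply: is_Cderive_eq (is_Cderive_cst _ x) _; rewrite (raddf0 (@ofR R)); ring.
have s0 : sqrtC lam != 0 by rewrite sqrtC_eq0.
have [sc ss] := (solves_Ccos (sqrtC lam) l, solves_Csin l s0).
rewrite sqrtCK in sc ss.
by split => //; rewrite (raddf0 (@ofR R)) mulr0 Ccos0 Csin0 mulr0.
Qed.

Lemma free_values g l (u : fundamental_family R g) s j : 0 <= l -> s != 0 ->
  is_fundamental l (fun _ => q0) u ->
  [/\ fc u j (s ^+ 2) l = Ccos (s * ofR l),
      dfc u j (s ^+ 2) l = - s * Csin (s * ofR l),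
      fs u j (s ^+ 2) l = s^-1 * Csin (s * ofR l)
    & Defs.dfs u j (s ^+ 2) l = Ccos (s * ofR l)].
Proof.
move=> l0 s0 hu; have [sc [c0 dc0] ss [ss0 ds0]] := hu j (s ^+ 2).
have z0 : s * ofR 0 = 0 by rewrite (raddf0 (@ofR R)) mulr0.
have basis := solves_wronskian_basis l0 (solves_Ccos s l) (solves_Csin l s0).
have [] := basis _ _ sc; rewrite ?z0 ?Ccos0 ?Csin0 ?mulr0 // => -> ->.
have [] := basis _ _ ss; rewrite ?z0 ?Ccos0 ?Csin0 ?mulr0 // => -> ->.
by rewrite c0 dc0 ss0 ds0 !mul0r !mul1r !addr0 !add0r.
Qed.

End FreeSolutions.

(** * The common sign *)

Section TreeSign.
Variable R : realType.
Local Notation K := (Cx R).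

Lemma poly_eq_on_nodes N n (P Q : {poly K}) : (0 < N)%N ->
  (size P <= n)%N -> (size Q <= n)%N ->
  (forall k, (k < n)%N -> P.[ofR (node R N k)] = Q.[ofR (node R N k)]) -> P = Q.
Proof.
move=> N0 sP sQ PQ; apply/eqP; rewrite -subr_eq0; apply/eqP.
pose rs := [seq ofR (node R N k) | k <- iota 0 n].
apply: (roots_geq_poly_eq0 (rs := rs)).
- apply/allP => x /mapP[k + ->]; rewrite mem_iota add0n => /andP[_ kn].
  by rewrite rootE !hornerE PQ // subrr.
- rewrite map_inj_uniq ?iota_uniq // => j k /fmorph_inj.
  have N0' : (N%:R : R)^-1 != 0 by rewrite invr_eq0 pnatr_eq0 -lt0n.
  by move=> /(mulIf N0')/eqP; rewrite eqr_nat => /eqP.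
- rewrite size_map size_iota.
  by apply: leq_trans (size_polyD _ _) _; rewrite size_polyN geq_max sP sQ.
Qed.

Variables (g : nat) (T : rooted_tree g).
Hypothesis g0 : (0 < g)%N.
Local Notation d0 := (vdeg (tadj T) ord0).
Local Notation q0 := (fun _ : R => 0 : R).

(** For the zero potential, the rescaled system at frequency [s] is the uniform
one. *)
Lemma free_determinants l (u : fundamental_family R g) s : 0 < l ->
  is_fundamental l (fun _ => q0) u -> Csin (s * ofR l) != 0 ->
  \det (Phi_N T u l (s ^+ 2)) =
    (-1) ^+ d0 * (s / Csin (s * ofR l) * (psi K T).[Ccos (s * ofR l)]) /\
  \det (Phi_D T u l (s ^+ 2)) = (-1) ^+ d0 * (psi_hat K T).[Ccos (s * ofR l)].
Proof.
move=> l0 hu S0; have CS := Ccos2Dsin2 (s * ofR l).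
have s0 : s != 0 by apply: contra_neq S0 => ->; rewrite mul0r Csin0.
have val j := free_values j (ltW l0) s0 hu.
pose v := const_family (fun j => fc u j (s ^+ 2) l) (fun j => dfc u j (s ^+ 2) l)
  (fun j => fs u j (s ^+ 2) l) (fun j => Defs.dfs u j (s ^+ 2) l).
have vE : v = const_family (fun=> Ccos (s * ofR l)) (fun=> - s * Csin (s * ofR l))
  (fun=> s^-1 * Csin (s * ofR l)) (fun=> Ccos (s * ofR l)).
  by congr FundamentalFamily; apply/funext => j; have [h1 h2 h3 h4] := val j;
    apply/funext => _; apply/funext => _.
have vscale : const_family (fun=> Ccos (s * ofR l))
    (fun=> - s * Csin (s * ofR l) / s) (fun=> s * (s^-1 * Csin (s * ofR l)))
    (fun=> Ccos (s * ofR l)) =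
    uniform_family g (Ccos (s * ofR l)) (Csin (s * ofR l)).
  by congr FundamentalFamily; apply/funext => j; apply/funext => _;
    apply/funext => _; field.
rewrite -[Phi_N T u _ _]/(Phi_N T v l (s ^+ 2)).
rewrite -[Phi_D T u _ _]/(Phi_D T v l (s ^+ 2)) vE.
rewrite (det_Phi_N_scale _ _ _ _ _ _ _ g0 s0) (det_Phi_D_scale _ _ _ _ _ _ _ s0).
rewrite vscale det_Phi_D_uniform //; split => //.
have := det_Phi_N_uniform T l (s ^+ 2) g0 S0 CS.
by move=> /(canRL (mulKf S0)) ->; ring.
Qed.

(** The zero-potential formulas hold with the sign [(-1) ^+ d0].  They fail with
the opposite one: [psi_hat] has degree [g], so it does not vanish at all of
[g + 1] nodes in [0, 1[, and at such a node the free solutions exhibit both a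
nonzero value and a nonzero sine. *)
Lemma tree_signE : tree_sign R T = (-1) ^+ d0.
Proof.
rewrite /tree_sign; case: asboolP => [norm1|norm1]; last first.
  case: (boolP (odd d0)) => [od|/negbTE ev]; first by rewrite -signr_odd od.
  case: norm1 => l u l0 hu s S0.
  have [-> ->] := free_determinants l0 hu S0.
  by rewrite -signr_odd ev expr0 !mul1r.
rewrite -signr_odd; case: (boolP (odd d0)) => [od|//].
have size_ph := size_psi_hat T (Cx R) g0.
have [k kg hk] : exists2 k, (k < g.+1)%N & (psi_hat K T).[ofR (node R g.+1 k)] != 0.
  apply: contrapT => no; have ph0 : psi_hat K T = 0.
    apply: (@poly_eq_on_nodes g.+1 g.+1); rewrite ?size_ph ?size_poly0 // => k kg.
    rewrite horner0; apply/eqP/negPn/negP => hk; apply: no.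
    by exists k.
  by move: size_ph; rewrite ph0 size_poly0.
set z := node R g.+1 k in hk.
have z0 : 0 <= z by rewrite divr_ge0.
have z1 : z < 1 by rewrite ltr_pdivrMr ?ltr0n // mul1r ltr_nat.
have zN1 : -1 <= z by rewrite (le_trans _ z0) // oppr_le0.
have sin_neq0 : sin (acos z) != 0.
  rewrite sin_acos ?zN1 ?ltW // sqrtr_eq0 -ltNge subr_gt0.
  by rewrite expr_lt1.
have hu := @is_fundamental_free R g 1.
have S0 : Csin (ofR (acos z) * ofR 1) != 0.
  by rewrite rmorph1 mulr1 Csin_ofR fmorph_eq0.
have [_ e1] := norm1 1 _ ltr01 hu _ S0.
have [_ e2] := free_determinants ltr01 hu S0.
move: e1; rewrite e2 mul1r rmorph1 mulr1 Ccos_ofR acosK ?in_itv /= ?zN1 ?ltW //.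
rewrite -signr_odd od expr1 mulN1r => /eqP.
by rewrite eq_sym -addr_eq0 -mulr2n mulrn_eq0 (negPf hk).
Qed.

End TreeSign.

(** * The scattering information *)

Section ScatteringLimits.
Variable R : realType.
Local Notation K := (Cx R).

Section Frequencies.
Variables (l : R) (N k : nat).
Hypotheses (l0 : 0 < l) (N0 : (0 < N)%N) (kN : (k <= N)%N).
Local Notation z := (node R N k).
Local Notation w := (sqrt_lambda l N k).

Lemma node_itv : 0 <= z <= 1.
Proof.
by rewrite divr_ge0 //= ler_pdivrMr ?ltr0n // mul1r ler_nat.
Qed.

Lemma node_acos : cos (acos z) = z.
Proof.
have /andP[z0 z1] := node_itv; apply: acosK.
by rewrite in_itv /= z1 (le_trans _ z0) // oppr_le0.
Qed.

Lemma cosDn2pi (x : R) n : cos (x + 2 * pi * n%:R) = cos x /\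
  sin (x + 2 * pi * n%:R) = sin x.
Proof.
have -> : 2 * pi * n%:R = pi *+ 2 *+ n :> R by rewrite mulr_natr mulr_natl.
by rewrite (periodicn (@cosD2pi R)) (periodicn (@sinD2pi R)).
Qed.

Lemma sqrt_lambdaM n : sqrt_lambda l N k n * l = acos z + 2 * pi * n%:R.
Proof. by rewrite divfK // gt_eqF. Qed.

Lemma cos_sqrt_lambda n : cos (w n * l) = z.
Proof. by rewrite sqrt_lambdaM (cosDn2pi _ n).1 node_acos. Qed.

Lemma sin_sqrt_lambda n : sin (w n * l) = sin (acos z).
Proof. by rewrite sqrt_lambdaM (cosDn2pi _ n).2. Qed.

Lemma cvg_sqrt_lambda : w n @[n --> \oo] --> +oo.
Proof.
apply/cvgryPge => A; near=> n.
rewrite ler_pdivlMr // (@le_trans _ _ (2 * pi * n%:R)) //; last first.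
  rewrite lerDr acos_ge0 //; have /andP[z0 ->] := node_itv.
  by rewrite (le_trans _ z0) // oppr_le0.
rewrite -ler_pdivrMl ?mulr_gt0 ?pi_gt0 //.
near: n; exact: nbhs_infty_ger.
Unshelve. all: by end_near. Qed.

End Frequencies.

Section Limits.
Variables (g : nat) (T : rooted_tree g) (l : R) (q : 'I_g -> R -> R).
Variable u : fundamental_family R g.
Hypotheses (g0 : (0 < g)%N) (l0 : 0 < l) (hq : forall j, L2_on l (q j)).
Hypothesis hu : is_fundamental l q u.

(** If the sine at the node vanishes, the node is 1; both sides are then zero,
the right one because the Laplacian of the tree is singular. *)
Lemma cvg_phi_N (N k : nat) : (0 < N)%N -> (k <= N)%N ->
  Csin (ofR (sqrt_lambda l N k n) * ofR l) / ofR (sqrt_lambda l N k n)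
    * phi_N T u l (ofR (sqrt_lambda l N k n) ^+ 2) @[n --> \oo] -->
  (psi K T).[ofR (node R N k)].
Proof.
move=> N0 kN; set w := sqrt_lambda l N k.
have wC := cos_sqrt_lambda l0 N0 kN; have wS := sin_sqrt_lambda N k l0.
have SE n : Csin (ofR (w n) * ofR l) = ofR (sin (acos (node R N k))).
  by rewrite -rmorphM Csin_ofR wS.
have CS : node R N k ^+ 2 + sin (acos (node R N k)) ^+ 2 = 1.
  by rewrite -{1}(node_acos N0 kN) cos2Dsin2.
have [S0|S0] := eqVneq (sin (acos (node R N k))) 0.
  have -> : node R N k = 1.
    have /andP[z0 _] := node_itv N0 kN.
    move: CS; rewrite S0 expr0n addr0 => /eqP; rewrite sqrf_eq1.
    case/orP => /eqP // zN1; move: z0; rewrite zN1 oppr_ge0 => /(lt_le_trans ltr01).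
    by rewrite ltxx.
  rewrite rmorph1 psi_at1; under eq_fun do rewrite SE S0 rmorph0 !mul0r.
  exact: cvg_cst.
have := cvg_det_Phi_N (T := T) l0 hq hu (cvg_sqrt_lambda l0 N0 kN) wC wS g0 CS S0.
set P := _.[_] => cvgP.
have -> : P = (-1) ^+ vdeg (tadj T) ord0 * ((-1) ^+ vdeg (tadj T) ord0 * P).
  by rewrite mulrA -expr2 sqrr_sign mul1r.
under eq_fun do rewrite SE /phi_N (tree_signE R T g0) mulrCA.
by apply: cvgM; [exact: cvg_cst|exact: cvgP].
Qed.

Lemma cvg_phi_D (N k : nat) : (0 < N)%N -> (k <= N)%N ->
  phi_D T u l (ofR (sqrt_lambda l N k n) ^+ 2) @[n --> \oo] -->
  (psi_hat K T).[ofR (node R N k)].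
Proof.
move=> N0 kN; set w := sqrt_lambda l N k.
have wC := cos_sqrt_lambda l0 N0 kN; have wS := sin_sqrt_lambda N k l0.
have CS : node R N k ^+ 2 + sin (acos (node R N k)) ^+ 2 = 1.
  by rewrite -{1}(node_acos N0 kN) cos2Dsin2.
have := cvg_det_Phi_D (T := T) l0 hq hu (cvg_sqrt_lambda l0 N0 kN) wC wS CS.
set P := _.[_] => cvgP.
have -> : P = (-1) ^+ vdeg (tadj T) ord0 * ((-1) ^+ vdeg (tadj T) ord0 * P).
  by rewrite mulrA -expr2 sqrr_sign mul1r.
under eq_fun do rewrite /phi_D (tree_signE R T g0).
by apply: cvgM; [exact: cvg_cst|exact: cvgP].
Qed.

End Limits.

Section ReducedData.
Variables (phiD phiN tphiD tphiN : K -> K) (m : nat) (j0 : option nat).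
Variables (nu : nat -> K) (l : R).
Hypothesis fac : reduced_factorization phiD phiN m j0 nu tphiD tphiN.
Local Notation tE := (jost tphiD tphiN).
Implicit Types s : K.

Lemma jost_factor s :
  jost phiD phiN s = (s ^+ 2) ^+ m * zero_product j0 nu (s ^+ 2) * tE s.
Proof. by rewrite /jost (rf_D fac) (rf_N fac); ring. Qed.

Lemma S_function_reduced s : jost phiD phiN s != 0 ->
  S_function phiD phiN s = tE (- s) / tE s.
Proof.
rewrite /S_function !jost_factor sqrrN mulf_eq0 negb_or => /andP[G0 _].
by rewrite -mulf_div divff // mul1r.
Qed.

Lemma scat_FE s :
  scat_F l m j0 nu tE s = Csin (s * ofR l) / s * phiN (s ^+ 2).
Proof.
have -> : phiN (s ^+ 2) = 2^-1 * ((s ^+ 2) ^+ m * zero_product j0 nu (s ^+ 2) *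
    (tE s + tE (- s))).
  by rewrite (rf_N fac) /jost sqrrN; field.
by rewrite /scat_F invfM; ring.
Qed.

Lemma scat_FhatE s : s != 0 -> scat_Fhat m j0 nu tE s = phiD (s ^+ 2).
Proof.
move=> s0; rewrite /scat_Fhat (rf_D fac) /jost sqrrN.
have i0 : 'i != 0 :> K by exact: neq0Ci.
by field; rewrite i0 s0.
Qed.

End ReducedData.

End ScatteringLimits.

Theorem theorem5p1 (R : realType) (g : nat) (hg : (1 <= g)%N)
    (T : rooted_tree g) (l : R) (hl : 0 < l)
    (q : 'I_g -> R -> R) (hq : forall j, L2_on l (q j))
    (u : fundamental_family R g) (hu : is_fundamental l q u)
    (m : nat) (j0 : option nat) (nu : nat -> Cx R)
    (tphiD tphiN : Cx R -> Cx R)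
    (hfac : reduced_factorization (phi_D T u l) (phi_N T u l)
              m j0 nu tphiD tphiN) :
  let p := g.+1 in
  let tE := jost tphiD tphiN in
  let F := scat_F l m j0 nu tE in
  let Fhat := scat_Fhat m j0 nu tE in
  let z := fun k : nat => ofR (node R p k) in
  let zhat := fun k : nat => ofR (node R p.-1 k) in
  let Fseq := fun k n : nat => F (ofR (sqrt_lambda l p k n)) in
  let Fhatseq := fun k n : nat => Fhat (ofR (sqrt_lambda l p.-1 k n)) in
  let f := fun k : nat => lim (Fseq k n @[n --> \oo]) in
  let fhat := fun k : nat => lim (Fhatseq k n @[n --> \oo]) in
  [/\ forall s, jost (phi_D T u l) (phi_N T u l) s != 0 ->
        S_function (phi_D T u l) (phi_N T u l) s = tE (- s) / tE s,
      (forall k, (k <= p)%N -> cvg (Fseq k n @[n --> \oo])) /\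
      (forall k, (k <= p.-1)%N -> cvg (Fhatseq k n @[n --> \oo])),
      size (psi (Cx R) T) = p.+1 /\ size (psi_hat (Cx R) T) = p,
      (forall k, (k <= p)%N -> (psi (Cx R) T).[z k] = f k) /\
      (forall P : {poly Cx R}, (size P <= p.+1)%N ->
         (forall k, (k <= p)%N -> P.[z k] = f k) -> P = psi (Cx R) T)
    & (forall k, (k <= p.-1)%N -> (psi_hat (Cx R) T).[zhat k] = fhat k) /\
      (forall P : {poly Cx R}, (size P <= p)%N ->
         (forall k, (k <= p.-1)%N -> P.[zhat k] = fhat k) ->
         P = psi_hat (Cx R) T)].
Proof.
move=> p tE F Fhat z zhat Fseq Fhatseq f fhat.
have cvgF k : (k <= p)%N -> Fseq k n @[n --> \oo] --> (psi (Cx R) T).[z k].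
  move=> kp; have := cvg_phi_N (T := T) hg hl hq hu (isT : (0 < p)%N) kp.
  by under eq_fun do rewrite -(scat_FE l hfac).
have cvgFhat k : (k <= p.-1)%N ->
    Fhatseq k n @[n --> \oo] --> (psi_hat (Cx R) T).[zhat k].
  move=> kp; apply: cvg_trans (cvg_phi_D (T := T) hg hl hq hu hg kp).
  apply: near_eq_cvg; near=> n.
  rewrite /Fhatseq /Fhat (scat_FhatE hfac) // fmorph_eq0 gt_eqF //.
  by near: n; move/cvgryPgt: (cvg_sqrt_lambda hl hg kp); exact.
have fE k : (k <= p)%N -> (psi (Cx R) T).[z k] = f k.
  by move=> kp; apply/esym/cvg_lim => //; exact: cvgF.
have fhatE k : (k <= p.-1)%N -> (psi_hat (Cx R) T).[zhat k] = fhat k.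
  by move=> kp; apply/esym/cvg_lim => //; exact: cvgFhat.
have [sz szh] := (size_psi T (Cx R) hg, size_psi_hat T (Cx R) hg).
split.
- by move=> s; exact: (S_function_reduced hfac).
- split=> k kp; apply/cvg_ex; first by exists (psi (Cx R) T).[z k]; exact: cvgF.
  by exists (psi_hat (Cx R) T).[zhat k]; exact: cvgFhat.
- by [].
- split=> // P sP PE; apply: (@poly_eq_on_nodes R p p.+1); rewrite ?sz //.
  by move=> k kp; rewrite PE // fE.
- split=> // P sP PE; apply: (@poly_eq_on_nodes R p.-1 p); rewrite ?szh //.
  by move=> k kp; rewrite PE // fhatE.
Unshelve. all: by end_near. Qed.
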